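(* Let $\mathbb X$ be a virtual equipment, let $j\colon A\to E$ and $j'\colon E\to I$ be tight-cells in $\mathbb X$, and let $T$ be a $(j;j')$-monad admitting an algebra object. Suppose that $j'$ is dense. Then $u_T\colon\mathrm{Alg}(T)\to I$ is strictly $j'$-monadic if and only if it admits a left $j'$-adjoint and the induced $j'$-monad admits an algebra object.
   Context: **Virtual equipments.** A virtual double category has objects, tight-cells $f\colon A\to B$ (forming a category; both $(f;g)$ and $gf$ denote $f$ followed by $g$), loose-cells, written $p\colon X\nrightarrow Y$, and 2-cells. A 2-cell has as top a chain of loose-cells $p_1\colon A_1\nrightarrow A_0,\dots,p_n\colon A_n\nrightarrow A_{n-1}$ ($n\ge 0$), as bottom a loose-cell $q\colon B_n\nrightarrow B_0$, and as sides tight-cells $f_0\colon A_0\to B_0$, $f_n\colon A_n\to B_n$; 2-cells paste multicategorically, associatively and unitally. $p_1,\dots,p_n\Rightarrow q$ denotes a 2-cell with identity sides. A virtual equipment is a virtual double category in which: every $p\colon X\nrightarrow Y$, $f\colon Z\to Y$, $g\colon W\to X$ admit a restriction $p(f,g)\colon W\nrightarrow Z$ (2-cells with bottom $p(f,g)$ and sides $h_0,h_n$ correspond bijectively, by pasting with a cartesian 2-cell, to 2-cells with bottom $p$ and sides $(h_0;f),(h_n;g)$); and every object $A$ has a loose-identity $A(1,1)\colon A\nrightarrow A$ (with a 2-cell from the empty chain to $A(1,1)$, pasting with which gives a bijection between 2-cells whose top chain contains $A(1,1)$ at a given place and 2-cells with that entry omitted). Write $B(f,g):=B(1,1)(f,g)$.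 A 2-cell $f\Rightarrow g$ between parallel tight-cells into $B$ is a 2-cell from the empty chain to $B(f,g)$. There are composition 2-cells $B(f,g),B(g,h)\Rightarrow B(f,h)$. A tight-cell $k\colon B\to C$ induces $B(f,g)\Rightarrow C(kf,kg)$, and $(\phi;k)$ denotes the composite of $\phi\colon p_1,\dots,p_n\Rightarrow B(f,g)$ with it. For $\phi\colon E(j,e)\Rightarrow E(t,e)$, $\phi(1,x)\colon E(j,ex)\Rightarrow E(t,ex)$ denotes restriction along $x$. The following definitions are for an arbitrary tight-cell $j\colon A\to E$ (the root), and are applied in the statement to the roots $j'$ and $(j;j')$. **Relative monads and algebras.** A $j$-monad $T=(t,\dagger,\eta)$ consists of a tight-cell $t\colon A\to E$ and 2-cells $\dagger\colon E(j,t)\Rightarrow E(t,t)$, $\eta\colon j\Rightarrow t$ such that: $\dagger$ followed by the 2-cell $E(t,t)\Rightarrow E(j,t)$ induced by $\eta$ is the identity; $\eta$ followed by $\dagger$ is the identity 2-cell on $t$; and the two 2-cells $E(j,t),E(j,t)\Rightarrow E(t,t)$, given by $(\dagger,\dagger)$ then composition, and by $\dagger$ on the second factor, then composition $E(j,t),E(t,t)\Rightarrow E(j,t)$, then $\dagger$, are equal. A $T$-algebra is a tight-cell $e\colon D\to E$ with a 2-cell $\rtimes\colon E(j,e)\Rightarrow E(t,e)$ such that $\rtimes$ followed by $E(t,e)\Rightarrow E(j,e)$ (induced by $\eta$) is the identity, and the two 2-cells $E(j,t),E(j,e)\Rightarrow E(t,e)$, given by $(\dagger,\rtimes)$ then composition,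 and by $\rtimes$ on the second factor, then composition $E(j,t),E(t,e)\Rightarrow E(j,e)$, then $\rtimes$, are equal. For a chain $p_1,\dots,p_n$ from $D$ (left end) to $D'$ (right end), a $(p_1,\dots,p_n)$-graded morphism $(e\colon D\to E,\rtimes)\to(e'\colon D'\to E,\rtimes')$ is a 2-cell $\epsilon\colon p_1,\dots,p_n\Rightarrow E(e,e')$ such that the two 2-cells $E(j,e),p_1,\dots,p_n\Rightarrow E(t,e')$, given by $\rtimes$ then composing with $\epsilon$, and by composing with $\epsilon$ then $\rtimes'$, are equal. An algebra object for $T$ is a $T$-algebra $(u_T\colon \mathrm{Alg}(T)\to E,\rtimes_T)$ such that (1) for every $T$-algebra $(e\colon D\to E,\rtimes)$ there is a unique tight-cell $\langle e\rangle\colon D\to\mathrm{Alg}(T)$ with $(\langle e\rangle;u_T)=e$ and $\rtimes_T(1,\langle e\rangle)=\rtimes$; (2) every graded $T$-algebra morphism $\epsilon\colon p_1,\dots,p_n\Rightarrow E(e,e')$ is $(\langle\epsilon\rangle;u_T)$ for a unique 2-cell $\langle\epsilon\rangle\colon p_1,\dots,p_n\Rightarrow\mathrm{Alg}(T)(\langle e\rangle,\langle e'\rangle)$. **Relative adjunctions.** A $j$-adjunction $\ell\dashv_j r$ with apex $C$ consists of tight-cells $\ell\colon A\to C$ (left $j$-adjoint), $r\colon C\to E$ (right $j$-adjoint) and an isomorphism $\sharp\colon C(\ell,1)\cong E(j,r)$. It induces a $j$-monad with carrier $(\ell;r)$, unit $j\Rightarrow r\ell$ the image under $\sharp$ of the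 identity on $\ell$, and extension operator $E(j,r\ell)\cong C(\ell,\ell)\Rightarrow E(r\ell,r\ell)$. If $\ell\dashv_j r$ induces $T$, then $r$ is a $T$-algebra via $E(j,r)\cong C(\ell,1)\Rightarrow E(r\ell,r)$; if $T$ admits an algebra object, the induced tight-cell $C\to\mathrm{Alg}(T)$ is the comparison tight-cell. **Strict monadicity.** $r\colon D\to E$ is strictly $j$-monadic if it admits a left $j$-adjoint, the induced $j$-monad $T$ admits an algebra object, and the comparison tight-cell $D\to\mathrm{Alg}(T)$ is an isomorphism. **Density.** $j\colon A\to E$ is dense if for all chains $q_1,\dots,q_n$ ($n\ge0$) of loose-cells from $E$ to $E$, composing with $E(j,1)$ (via $E(j,1),E(1,1)\Rightarrow E(j,1)$) is a bijection from 2-cells $q_1,\dots,q_n\Rightarrow E(1,1)$ to 2-cells $E(j,1),q_1,\dots,q_n\Rightarrow E(j,1)$; that is, $1_E$ with the identity 2-cell on $E(j,1)$ is the $E(j,1)$-weighted colimit of $j$. *)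

(* Defs.v *)
From mathcomp Require Import ssreflect ssrfun.
From Stdlib Require Import ProofIrrelevance.

Set Implicit Arguments.
Unset Strict Implicit.
Unset Printing Implicit Defensive.

(** A chain [p_1 : A_1 -/-> A_0, ..., p_n : A_n -/-> A_(n-1)], listed from its
    left end [A_0] to its right end [A_n]. *)
Inductive chain (ob : Type) (loose : ob -> ob -> Type) : ob -> ob -> Type :=
| cnil A : chain loose A A
| ccons A0 A1 An : loose A1 A0 -> chain loose A1 An -> chain loose A0 An.
Arguments cnil {ob loose} A.
Arguments ccons {ob loose A0 A1 An} p P.

Fixpoint capp (ob : Type) (loose : ob -> ob -> Type) (A0 A1 A2 : ob)
    (P : chain loose A0 A1) : chain loose A1 A2 -> chain loose A0 A2 :=
  match P with
  | cnil _ => fun Q => Q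
  | ccons _ _ _ p P' => fun Q => ccons p (capp P' Q)
  end.

Notation "[ 'ch' p ]" := (ccons p (cnil _)) (format "[ 'ch'  p ]").
Notation "[ 'ch' p , q ]" := (ccons p (ccons q (cnil _)))
  (format "[ 'ch'  p ,  q ]").

Lemma capp_nil (ob : Type) (loose : ob -> ob -> Type) (A0 A1 : ob)
  (P : chain loose A0 A1) : capp P (cnil A1) = P.
Proof. by elim: P => [//|A B C p P /= ->]. Qed.

Lemma cappA (ob : Type) (loose : ob -> ob -> Type) (A0 A1 A2 A3 : ob)
  (P : chain loose A0 A1) (Q : chain loose A1 A2) (R : chain loose A2 A3) :
  capp (capp P Q) R = capp P (capp Q R).
Proof. by elim: P Q => [//|A B C p P IH] Q /=; rewrite IH. Qed.

(** The category of objects and tight-cells, with the loose-cells and the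
    2-cells.  [cell f0 fn P q] has top [P], bottom [q] and sides [f0], [fn]. *)
Record vdc_graph : Type := VdcGraph {
  ob :> Type;
  tight : ob -> ob -> Type;
  tid : forall A, tight A A;
  tcomp : forall A B C, tight A B -> tight B C -> tight A C;
  tcomp1l : forall A B (f : tight A B), tcomp (tid A) f = f;
  tcomp1r : forall A B (f : tight A B), tcomp f (tid B) = f;
  tcompA : forall A B C D (f : tight A B) (g : tight B C) (h : tight C D),
    tcomp f (tcomp g h) = tcomp (tcomp f g) h;
  loose : ob -> ob -> Type;
  cell : forall A0 An B0 Bn, tight A0 B0 -> tight An Bn ->
    chain loose A0 An -> loose Bn B0 -> Type
}.
Arguments tid {v} A.
Arguments tcomp {v A B C} f g.
Arguments tight {v} A B.
Arguments loose {v} A B.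
Arguments cell {v A0 An B0 Bn} f0 fn P q.

(** Diagrammatic order: [f >> g] is [f] followed by [g]. *)
Notation "f >> g" := (tcomp f g) (at level 40, left associativity).

Notation path X := (chain (@loose X)).

Section Cells.
Variable X : vdc_graph.

(** Side-by-side 2-cells, with top [P] (the concatenation of their tops) and
    bottom chain [Q].  The top is given up to a proof of equality, so that no
    transport along associativity of concatenation is ever needed. *)
Inductive cells : forall A0 An B0 Bn : X,
    tight A0 B0 -> tight An Bn -> path X A0 An -> path X B0 Bn -> Type :=
| cells_nil A B (f : tight A B) : cells f f (cnil A) (cnil B)
| cells_cons A0 A1 An B0 B1 Bn
    (f0 : tight A0 B0) (f1 : tight A1 B1) (fn : tight An Bn)
    (P : path X A0 A1) (P' : path X A1 An) (PP : path X A0 An)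
    (q : loose B1 B0) (Q : path X B1 Bn) :
    cell f0 f1 P q -> cells f1 fn P' Q -> capp P P' = PP ->
    cells f0 fn PP (ccons q Q).

(** [cells_cat Phi1 Phi2 Phi]: [Phi] is [Phi1] followed by [Phi2]. *)
Inductive cells_cat : forall A0 A1 An B0 B1 Bn
    (f0 : tight A0 B0) (f1 : tight A1 B1) (fn : tight An Bn) P1 P2 P Q1 Q2 Q,
    cells f0 f1 P1 Q1 -> cells f1 fn P2 Q2 -> cells f0 fn P Q -> Prop :=
| cells_cat_nil A An B Bn (f : tight A B) (fn : tight An Bn) P Q
    (Phi : cells f fn P Q) : cells_cat (cells_nil f) Phi Phi
| cells_cat_cons A0 A1 A2 An B0 B1 B2 Bn
    (f0 : tight A0 B0) (f1 : tight A1 B1) (f2 : tight A2 B2) (fn : tight An Bn)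
    P0 P1 P01 P2 P P' q Q1 Q2 Q
    (phi : cell f0 f1 P0 q) (Phi1 : cells f1 f2 P1 Q1)
    (Phi2 : cells f2 fn P2 Q2) (Phi : cells f1 fn P Q)
    (e : capp P0 P1 = P01) (e' : capp P0 P = P') :
    cells_cat Phi1 Phi2 Phi ->
    cells_cat (cells_cons phi Phi1 e) Phi2 (cells_cons phi Phi e').

Definition one A0 An B0 Bn (f0 : tight A0 B0) (fn : tight An Bn) P q
    (phi : cell f0 fn P q) : cells f0 fn P [ch q] :=
  cells_cons phi (cells_nil fn) (capp_nil P).

Definition two A0 A1 An B0 B1 Bn
    (f0 : tight A0 B0) (f1 : tight A1 B1) (fn : tight An Bn) P Q p q
    (phi : cell f0 f1 P p) (psi : cell f1 fn Q q) :
    cells f0 fn (capp P Q) [ch p, q] :=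
  cells_cons phi (one psi) erefl.

End Cells.

(** Identity 2-cells and pasting.  The sides of a pasting are given up to
    proofs of equality, for the same reason as above. *)
Record vdc_ops : Type := VdcOps {
  vgraph :> vdc_graph;
  cid : forall (A B : vgraph) (p : loose A B), cell (tid B) (tid A) [ch p] p;
  paste : forall (A0 An B0 Bn C0 Cn : vgraph)
    (f0 : tight A0 B0) (fn : tight An Bn) (g0 : tight B0 C0) (gn : tight Bn Cn)
    (h0 : tight A0 C0) (hn : tight An Cn) P Q r,
    cells f0 fn P Q -> cell g0 gn Q r -> f0 >> g0 = h0 -> fn >> gn = hn ->
    cell h0 hn P r
}.
Arguments cid {v A B} p.
Arguments paste {v A0 An B0 Bn C0 Cn f0 fn g0 gn h0 hn P Q r} Phi psi e0 en.

Section Ops.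
Variable X : vdc_ops.

Fixpoint cids (A0 An : X) (P : path X A0 An) : cells (tid A0) (tid An) P P :=
  match P with
  | cnil A => cells_nil (tid A)
  | ccons _ _ _ p P' => cells_cons (cid p) (cids P') erefl
  end.

(** [pasted Phi Psi Theta]: the rows [Phi] and [Psi] compose to [Theta], each
    2-cell of [Theta] being the pasting of a 2-cell of [Psi] with the block of
    [Phi] above it. *)
Inductive pasted : forall (A0 An B0 Bn C0 Cn : X)
    (f0 : tight A0 B0) (fn : tight An Bn) (g0 : tight B0 C0) (gn : tight Bn Cn)
    (h0 : tight A0 C0) (hn : tight An Cn) P Q R,
    cells f0 fn P Q -> cells g0 gn Q R -> cells h0 hn P R -> Prop :=
| pasted_nil A B C (f : tight A B) (g : tight B C) (h : tight A C) :
    f >> g = h -> pasted (cells_nil f) (cells_nil g) (cells_nil h)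
| pasted_cons A0 A1 An B0 B1 Bn C0 C1 Cn
    (f0 : tight A0 B0) (f1 : tight A1 B1) (fn : tight An Bn)
    (g0 : tight B0 C0) (g1 : tight B1 C1) (gn : tight Bn Cn)
    (h0 : tight A0 C0) (h1 : tight A1 C1) (hn : tight An Cn)
    P1 P2 P Q1 Q2 Q r R
    (Phi1 : cells f0 f1 P1 Q1) (Phi2 : cells f1 fn P2 Q2) (Phi : cells f0 fn P Q)
    (psi : cell g0 g1 Q1 r) (Psi : cells g1 gn Q2 R) (Theta : cells h1 hn P2 R)
    (e0 : f0 >> g0 = h0) (e1 : f1 >> g1 = h1)
    (eP : capp P1 P2 = P) (eQ : capp Q1 Q2 = Q) :
    cells_cat Phi1 Phi2 Phi -> pasted Phi2 Psi Theta ->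
    pasted Phi (cells_cons psi Psi eQ)
           (cells_cons (paste Phi1 psi e0 e1) Theta eP).

End Ops.

Record virtual_double_category : Type := VirtualDoubleCategory {
  vops :> vdc_ops;
  paste1l : forall (A0 An B0 Bn : vops) (f0 : tight A0 B0) (fn : tight An Bn)
    P q (phi : cell f0 fn P q) e0 en, paste (cids P) phi e0 en = phi;
  paste1r : forall (A0 An B0 Bn : vops) (f0 : tight A0 B0) (fn : tight An Bn)
    P q (phi : cell f0 fn P q) e0 en, paste (one phi) (cid q) e0 en = phi;
  pasteA : forall (A0 An B0 Bn C0 Cn D0 Dn : vops)
    (f0 : tight A0 B0) (fn : tight An Bn) (g0 : tight B0 C0) (gn : tight Bn Cn)
    (h0 : tight A0 C0) (hn : tight An Cn) (k0 : tight C0 D0) (kn : tight Cn Dn)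
    (m0 : tight B0 D0) (mn : tight Bn Dn) (n0 : tight A0 D0) (nn : tight An Dn)
    P Q R s (Phi : cells f0 fn P Q) (Psi : cells g0 gn Q R)
    (Theta : cells h0 hn P R) (chi : cell k0 kn R s)
    (a0 : g0 >> k0 = m0) (an : gn >> kn = mn)
    (b0 : f0 >> m0 = n0) (bn : fn >> mn = nn)
    (c0 : h0 >> k0 = n0) (cn : hn >> kn = nn),
    pasted Phi Psi Theta ->
    paste Phi (paste Psi chi a0 an) b0 bn = paste Theta chi c0 cn
}.

(** Any two composable rows compose, so [pasteA] is associativity in full. *)
Section Total.
Variable X : vdc_ops.

Definition cells_split_stmt (B0 B1 : X) (Q1 : path X B0 B1) : Prop :=
  forall Bn (Q2 : path X B1 Bn) A0 An (f0 : tight A0 B0) (fn : tight An Bn) P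
    (Phi : cells f0 fn P (capp Q1 Q2)),
  exists A1 (f1 : tight A1 B1) P1 P2
    (Phi1 : cells f0 f1 P1 Q1) (Phi2 : cells f1 fn P2 Q2),
    capp P1 P2 = P /\ cells_cat Phi1 Phi2 Phi.

Definition cells_uncons_stmt (A0 An B0 Bn : X)
    (f0 : tight A0 B0) (fn : tight An Bn) P (QQ : path X B0 Bn) :
    cells f0 fn P QQ -> Prop :=
  match QQ in chain _ b0 bn return
    forall (f0 : tight A0 b0) (fn : tight An bn), cells f0 fn P QQ -> Prop with
  | cnil B => fun f0 fn Phi =>
     forall K : (forall A1 A2 (f : tight A1 B) (g : tight A2 B)
       (P : path X A1 A2), cells f g P (cnil B) -> Prop),
     (forall A1 (f : tight A1 B), K _ _ _ _ _ (cells_nil f)) ->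
     K _ _ _ _ _ Phi
  | ccons b0 b1 bn q Q => fun f0 fn Phi =>
     exists A1 (f1 : tight A1 b1) P0 P' (phi : cell f0 f1 P0 q)
       (Phi' : cells f1 fn P' Q) (e : capp P0 P' = P), Phi = cells_cons phi Phi' e
  end f0 fn.

Lemma cells_uncons (A0 An B0 Bn : X) (f0 : tight A0 B0) (fn : tight An Bn) P
  (QQ : path X B0 Bn) (Phi : cells f0 fn P QQ) : cells_uncons_stmt Phi.
Proof.
case: Phi => [A B f K H|]; first exact: H.
by move=> *; do 7 eexists.
Qed.

Lemma cells_split (B0 B1 : X) (Q1 : path X B0 B1) : cells_split_stmt Q1.
Proof.
elim: Q1 => [B|b0 b1 b2 q Q1 IH] Bn Q2 A0 An f0 fn P Phi.
  by exists A0, f0, (cnil A0), P, (cells_nil f0), Phi; split => //; constructor.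
have [A1 [f1 [P0 [P' [phi [Phi' [e ->]]]]]]] := cells_uncons Phi.
have [A2 [f2 [P1 [P2 [Phi1 [Phi2 [e' cat]]]]]]] := IH _ _ _ _ _ _ _ Phi'.
exists A2, f2, (capp P0 P1), P2, (cells_cons phi Phi1 erefl), Phi2.
by split; [rewrite cappA e'|constructor].
Qed.

Lemma pasted_total (A0 An B0 Bn C0 Cn : X)
  (f0 : tight A0 B0) (fn : tight An Bn) (g0 : tight B0 C0) (gn : tight Bn Cn)
  P Q R (Phi : cells f0 fn P Q) (Psi : cells g0 gn Q R) :
  exists Theta : cells (f0 >> g0) (fn >> gn) P R, pasted Phi Psi Theta.
Proof.
elim: Psi A0 An f0 fn P Phi => {B0 Bn C0 Cn g0 gn Q R} [B C g|].
  move=> A0 An f0 fn P Phi.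
  move: (cells_uncons Phi) => /= /(_ (fun A1 A2 f0 fn P Phi => exists
    Theta : cells (f0 >> g) (fn >> g) P (cnil C), pasted Phi (cells_nil g) Theta)).
  apply.
  by move=> A f; exists (cells_nil (f >> g)); constructor.
move=> B0 B1 Bn C0 C1 Cn g0 g1 gn Q1 Q2 Q r R psi Psi IH eQ.
case: Q / eQ => A0 An f0 fn P Phi.
have [A1 [f1 [P1 [P2 [Phi1 [Phi2 [e cat]]]]]]] := cells_split Phi.
have [Theta H] := IH _ _ _ _ _ Phi2.
exists (cells_cons (paste Phi1 psi erefl erefl) Theta e).
exact: pasted_cons H.
Qed.

End Total.

(** The row with a 2-cell [u] from the empty chain inserted between the
    identity 2-cells on [P] and those on [Q]. *)
Fixpoint cinsert (X : vdc_ops) (A0 A An : X) (l : loose A A)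
    (u : cell (tid A) (tid A) (cnil A) l) (P : path X A0 A) :
    forall Q : path X A An,
    cells (tid A0) (tid An) (capp P Q) (capp P (ccons l Q)) :=
  match P in chain _ a0 a return
    forall (l : loose a a), cell (tid a) (tid a) (cnil a) l ->
    forall Q : path X a An,
    cells (tid a0) (tid An) (capp P Q) (capp P (ccons l Q)) with
  | cnil A => fun l u Q => cells_cons u (cids Q) erefl
  | ccons _ _ _ p P' => fun l u Q => cells_cons (cid p) (cinsert u P' Q) erefl
  end l u.

(** Restrictions and loose-identities are chosen; the inverses [res_fact] and
    [lid_fact] of the two pasting bijections are part of the structure (they
    are determined by the rest of it). *)
Record virtual_equipment : Type := VirtualEquipment {
  vdc :> virtual_double_category;

  res : forall (V Y Z W : vdc), loose V Y -> tight Z Y -> tight W V -> loose W Z;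
  cart : forall (V Y Z W : vdc) (p : loose V Y) (f : tight Z Y) (g : tight W V),
    cell f g [ch res p f g] p;
  res_fact : forall (V Y Z W : vdc) (p : loose V Y) (f : tight Z Y)
    (g : tight W V) (A0 An : vdc) (h0 : tight A0 Z) (hn : tight An W)
    (k0 : tight A0 Y) (kn : tight An V) (P : path vdc A0 An),
    h0 >> f = k0 -> hn >> g = kn -> cell k0 kn P p -> cell h0 hn P (res p f g);
  res_factK : forall (V Y Z W : vdc) (p : loose V Y) (f : tight Z Y)
    (g : tight W V) (A0 An : vdc) (h0 : tight A0 Z) (hn : tight An W)
    (k0 : tight A0 Y) (kn : tight An V) (P : path vdc A0 An)
    (e0 : h0 >> f = k0) (en : hn >> g = kn),
    cancel (@res_fact _ _ _ _ p f g _ _ _ _ _ _ P e0 en)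
           (fun phi => paste (one phi) (cart p f g) e0 en);
  cart_factK : forall (V Y Z W : vdc) (p : loose V Y) (f : tight Z Y)
    (g : tight W V) (A0 An : vdc) (h0 : tight A0 Z) (hn : tight An W)
    (k0 : tight A0 Y) (kn : tight An V) (P : path vdc A0 An)
    (e0 : h0 >> f = k0) (en : hn >> g = kn),
    cancel (fun phi => paste (one phi) (cart p f g) e0 en)
           (@res_fact _ _ _ _ p f g _ _ _ _ _ _ P e0 en);

  lid : forall A : vdc, loose A A;
  lunit : forall A : vdc, cell (tid A) (tid A) (cnil A) (lid A);
  lid_fact : forall (A0 A An B0 Bn : vdc) (f0 : tight A0 B0) (fn : tight An Bn)
    (P : path vdc A0 A) (Q : path vdc A An) (r : loose Bn B0),
    cell f0 fn (capp P Q) r -> cell f0 fn (capp P (ccons (lid A) Q)) r;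
  lid_factK : forall (A0 A An B0 Bn : vdc) (f0 : tight A0 B0) (fn : tight An Bn)
    (P : path vdc A0 A) (Q : path vdc A An) (r : loose Bn B0),
    cancel (@lid_fact _ _ _ _ _ f0 fn P Q r)
           (fun phi => paste (cinsert (lunit A) P Q) phi (tcomp1l _) (tcomp1l _));
  insert_factK : forall (A0 A An B0 Bn : vdc) (f0 : tight A0 B0)
    (fn : tight An Bn) (P : path vdc A0 A) (Q : path vdc A An) (r : loose Bn B0),
    cancel (fun phi => paste (cinsert (lunit A) P Q) phi (tcomp1l _) (tcomp1l _))
           (@lid_fact _ _ _ _ _ f0 fn P Q r)
}.
Arguments res {v V Y Z W} p f g.
Arguments cart {v V Y Z W} p f g.
Arguments res_fact {v V Y Z W} p f g {A0 An h0 hn k0 kn P} e0 en phi.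
Arguments lid {v} A.
Arguments lunit {v} A.
Arguments lid_fact {v A0 A An B0 Bn f0 fn} P Q {r} phi.

Notation "P =>> q" := (cell (tid _) (tid _) P q) (at level 70, no associativity).

Section Equipment.
Variable X : virtual_equipment.

(** [hom f g] is [B(f, g) : Z -/-> Y]. *)
Definition hom (B Y Z : X) (f : tight Y B) (g : tight Z B) : loose Z Y :=
  res (lid B) f g.

Definition hcart (B Y Z : X) (f : tight Y B) (g : tight Z B) :
  cell f g [ch hom f g] (lid B) := cart (lid B) f g.

Definition gpaste (A0 An B0 Bn : X) (f0 : tight A0 B0) (fn : tight An Bn) P Q r
    (Phi : cells f0 fn P Q) (psi : Q =>> r) : cell f0 fn P r :=
  paste Phi psi (tcomp1r _) (tcomp1r _).

Definition vert (A0 An B0 Bn : X) (f0 : tight A0 B0) (fn : tight An Bn)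
    P (q r : loose Bn B0) (phi : cell f0 fn P q) (psi : [ch q] =>> r) :
    cell f0 fn P r := gpaste (one phi) psi.

Definition id2 (Y B : X) (f : tight Y B) : cnil Y =>> hom f f :=
  res_fact (lid B) f f (tcomp1l f) (tcomp1l f)
    (paste (cells_nil f) (lunit B) (tcomp1r f) (tcomp1r f)).

Definition lmul (B : X) : [ch lid B, lid B] =>> lid B :=
  lid_fact (cnil B) [ch lid B] (cid (lid B)).

Definition mu (B Y Z W : X) (f : tight Y B) (g : tight Z B) (h : tight W B) :
    [ch hom f g, hom g h] =>> hom f h :=
  res_fact (lid B) f h (tcomp1l f) (tcomp1l h)
    (gpaste (two (hcart f g) (hcart g h)) (lmul B)).

(** [(phi, psi)] then composition. *)
Definition hcomp (B Y Z W : X) (f : tight Y B) (g : tight Z B) (h : tight W B)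
    P Q (phi : P =>> hom f g) (psi : Q =>> hom g h) : capp P Q =>> hom f h :=
  gpaste (two phi psi) (mu f g h).

(** The 2-cell [B(g, h) => B(f, h)] induced by [eta : f => g]. *)
Definition precomp (B Y W : X) (f g : tight Y B) (h : tight W B)
    (eta : cnil Y =>> hom f g) : [ch hom g h] =>> hom f h :=
  hcomp eta (cid (hom g h)).

Definition lmap (B C : X) (k : tight B C) : cell k k [ch lid B] (lid C) :=
  lid_fact (cnil B) (cnil B)
    (paste (cells_nil k) (lunit C) (tcomp1r k) (tcomp1r k)).

(** The 2-cell [B(f, g) => C(kf, kg)] induced by [k]; [f'] and [g'] stand for
    the composites [f >> k] and [g >> k]. *)
Definition act (B C Y Z : X) (k : tight B C) (f : tight Y B) (g : tight Z B)
    f' g' (ef : f >> k = f') (eg : g >> k = g') : [ch hom f g] =>> hom f' g' :=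
  res_fact (lid C) f' g' (tcomp1l f') (tcomp1l g')
    (paste (one (hcart f g)) (lmap k) ef eg).

(** [(phi; k)]. *)
Definition whisker (B C Y Z : X) (k : tight B C) (f : tight Y B) (g : tight Z B)
    P (phi : P =>> hom f g) f' g' (ef : f >> k = f') (eg : g >> k = g') :
    P =>> hom f' g' :=
  vert phi (act ef eg).

(** The canonical 2-cell [B(f, gx) => B(f, g)] with sides [1] and [x]. *)
Definition hproj (B Y Z W : X) (f : tight Y B) (g : tight Z B) (x : tight W Z)
    g' (e : x >> g = g') : cell (tid Y) x [ch hom f g'] (hom f g) :=
  res_fact (lid B) f g (tcomp1l f) e (hcart f g').

(** [phi(1, x) : B(f, gx) => C(h, kx)], for [phi : B(f, g) => C(h, k)]. *)
Definition restr (B C Y Z W : X) (f : tight Y B) (g : tight Z B)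
    (h : tight Y C) (k : tight Z C) (phi : [ch hom f g] =>> hom h k)
    (x : tight W Z) g' k' (eg : x >> g = g') (ek : x >> k = k') :
    [ch hom f g'] =>> hom h k' :=
  res_fact (lid C) h k' (tcomp1l h) (tcomp1l k')
    (paste (one (gpaste (one (hproj f eg)) phi)) (hcart h k) (tcomp1l h) ek).

Record monad (A E : X) (j : tight A E) : Type := Monad {
  mt : tight A E;
  mext : [ch hom j mt] =>> hom mt mt;
  munit : cnil A =>> hom j mt;
  mext_unit : vert mext (precomp mt munit) = cid (hom j mt);
  munit_ext : vert munit mext = id2 mt;
  mext_ext : hcomp mext mext = vert (hcomp (cid (hom j mt)) mext) mext
}.

Record algebra (A E : X) (j : tight A E) (T : monad j) (D : X) : Type := Algebra {
  ae : tight D E;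
  aop : [ch hom j ae] =>> hom (mt T) ae;
  aop_unit : vert aop (precomp ae (munit T)) = cid (hom j ae);
  aop_ext : hcomp (mext T) aop = vert (hcomp (cid (hom j (mt T))) aop) aop
}.

Definition graded_morphism (A E : X) (j : tight A E) (T : monad j) (D D' : X)
    (a : algebra T D) (a' : algebra T D') (P : path X D D')
    (eps : P =>> hom (ae a) (ae a')) : Prop :=
  hcomp (aop a) eps = vert (hcomp (cid (hom j (ae a))) eps) (aop a').

(** [aoalg] is [(u_T, rtimes_T)] and [aomed a] is [<e>] for [a = (e, rtimes)]. *)
Record algebra_object (A E : X) (j : tight A E) (T : monad j) : Type :=
  AlgebraObject {
  aoob : X;
  aoalg : algebra T aoob;
  aomed : forall D, algebra T D -> tight D aoob;
  aomedE : forall D (a : algebra T D), aomed a >> ae aoalg = ae a;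
  aomed_op : forall D (a : algebra T D),
    restr (aop aoalg) (aomedE a) (aomedE a)
      = aop a;
  aomed_uniq : forall D (a : algebra T D) (x : tight D aoob)
    (e : x >> ae aoalg = ae a),
    restr (aop aoalg) e e = aop a -> x = aomed a;
  aomed2 : forall D D' (a : algebra T D) (a' : algebra T D') (P : path X D D')
    (eps : P =>> hom (ae a) (ae a')), graded_morphism eps ->
    exists! eps' : P =>> hom (aomed a) (aomed a'),
      whisker eps' (aomedE a) (aomedE a') = eps
}.

End Equipment.

Section Pasting.
Variable X : virtual_double_category.

Lemma paste_irr (A0 An B0 Bn C0 Cn : X)
  (f0 : tight A0 B0) (fn : tight An Bn) (g0 : tight B0 C0) (gn : tight Bn Cn)
  (h0 : tight A0 C0) (hn : tight An Cn) P Q r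
  (Phi : cells f0 fn P Q) (psi : cell g0 gn Q r)
  (e0 e0' : f0 >> g0 = h0) (en en' : fn >> gn = hn) :
  paste Phi psi e0 en = paste Phi psi e0' en'.
Proof.
by rewrite (proof_irrelevance _ e0 e0') (proof_irrelevance _ en en').
Qed.

Lemma cells_cat_nilr (A0 An B0 Bn : X) (f0 : tight A0 B0) (fn : tight An Bn)
  P Q (Phi : cells f0 fn P Q) : cells_cat Phi (cells_nil fn) Phi.
Proof. by elim: Phi => *; constructor. Qed.

Lemma paste_one (A0 An B0 Bn C0 Cn D0 Dn : X)
  (f0 : tight A0 B0) (fn : tight An Bn) (g0 : tight B0 C0) (gn : tight Bn Cn)
  (h0 : tight A0 C0) (hn : tight An Cn) (k0 : tight C0 D0) (kn : tight Cn Dn)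
  (m0 : tight B0 D0) (mn : tight Bn Dn) (n0 : tight A0 D0) (nn : tight An Dn)
  P Q r s (Phi : cells f0 fn P Q) (psi : cell g0 gn Q r) (chi : cell k0 kn [ch r] s)
  (a0 : g0 >> k0 = m0) (an : gn >> kn = mn)
  (b0 : f0 >> m0 = n0) (bn : fn >> mn = nn)
  (d0 : f0 >> g0 = h0) (dn : fn >> gn = hn)
  (c0 : h0 >> k0 = n0) (cn : hn >> kn = nn) :
  paste (one (paste Phi psi d0 dn)) chi c0 cn
    = paste Phi (paste (one psi) chi a0 an) b0 bn.
Proof.
symmetry; apply: pasteA.
by apply: pasted_cons (cells_cat_nilr _) _; constructor.
Qed.

Lemma paste_two (A0 A1 An B0 B1 Bn C0 C1 Cn D0 Dn : X)
  (f0 : tight A0 B0) (f1 : tight A1 B1) (fn : tight An Bn)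
  (g0 : tight B0 C0) (g1 : tight B1 C1) (gn : tight Bn Cn)
  (h0 : tight A0 C0) (h1 : tight A1 C1) (hn : tight An Cn)
  (k0 : tight C0 D0) (kn : tight Cn Dn)
  (m0 : tight B0 D0) (mn : tight Bn Dn) (n0 : tight A0 D0) (nn : tight An Dn)
  P1 P2 Q1 Q2 r1 r2 s (Phi1 : cells f0 f1 P1 Q1) (Phi2 : cells f1 fn P2 Q2)
  (Phi : cells f0 fn (capp P1 P2) (capp Q1 Q2))
  (psi1 : cell g0 g1 Q1 r1) (psi2 : cell g1 gn Q2 r2)
  (chi : cell k0 kn [ch r1, r2] s)
  (a0 : g0 >> k0 = m0) (an : gn >> kn = mn)
  (b0 : f0 >> m0 = n0) (bn : fn >> mn = nn)
  (d0 : f0 >> g0 = h0) (d1 d1' : f1 >> g1 = h1) (dn : fn >> gn = hn)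
  (c0 : h0 >> k0 = n0) (cn : hn >> kn = nn) :
  cells_cat Phi1 Phi2 Phi ->
  paste (two (paste Phi1 psi1 d0 d1) (paste Phi2 psi2 d1' dn)) chi c0 cn
    = paste Phi (paste (two psi1 psi2) chi a0 an) b0 bn.
Proof.
move=> cat; symmetry; apply: pasteA.
apply: pasted_cons cat _.
by apply: pasted_cons (cells_cat_nilr _) _; constructor.
Qed.

Lemma cids_one (A B : X) (p : loose A B) : cids [ch p] = one (cid p).
Proof. by rewrite /one (proof_irrelevance _ (capp_nil _) erefl). Qed.

Lemma cids_two (A B C : X) (p : loose B A) (q : loose C B) :
  cids [ch p, q] = two (cid p) (cid q).
Proof. by rewrite /two -cids_one. Qed.

Lemma paste_one1l (A B B0 Bn : X) (p : loose A B) (f0 : tight B B0)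
  (fn : tight A Bn) q (phi : cell f0 fn [ch p] q) e0 en :
  paste (one (cid p)) phi e0 en = phi.
Proof. by rewrite -cids_one paste1l. Qed.

Lemma cells_cat_one (A0 A1 An B0 B1 Bn : X)
    (f0 : tight A0 B0) (f1 : tight A1 B1) (fn : tight An Bn) P Q p q
    (phi : cell f0 f1 P p) (psi : cell f1 fn Q q) :
  cells_cat (one phi) (one psi) (two phi psi).
Proof. by do 2! constructor. Qed.

End Pasting.

Section EquipmentTheory.
Variable X : virtual_equipment.

Lemma lid_inj (A0 A An B0 Bn : X) (f0 : tight A0 B0) (fn : tight An Bn)
  (P : path X A0 A) (Q : path X A An) (r : loose Bn B0)
  (phi psi : cell f0 fn (capp P (ccons (lid A) Q)) r) :
  paste (cinsert (lunit A) P Q) phi (tcomp1l _) (tcomp1l _)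
    = paste (cinsert (lunit A) P Q) psi (tcomp1l _) (tcomp1l _) -> phi = psi.
Proof. exact: (can_inj (@insert_factK _ _ _ _ _ _ f0 fn P Q r)). Qed.

Lemma res_inj (V Y Z W : X) (p : loose V Y) (f : tight Z Y)
    (g : tight W V) (A0 An : X) (h0 : tight A0 Z) (hn : tight An W)
    (k0 : tight A0 Y) (kn : tight An V) (P : path X A0 An)
    (e0 : h0 >> f = k0) (en : hn >> g = kn) (phi psi : cell h0 hn P (res p f g)) :
  paste (one phi) (cart p f g) e0 en = paste (one psi) (cart p f g) e0 en ->
  phi = psi.
Proof. exact: (can_inj (@cart_factK _ _ _ _ _ p f g _ _ _ _ _ _ P e0 en)). Qed.

Lemma cinsert00 (A : X) :
  cinsert (lunit A) (cnil A) (cnil A) = one (lunit A).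
Proof. by rewrite /one (proof_irrelevance _ (capp_nil _) erefl). Qed.

Lemma cinsert01 (A B : X) (p : loose B A) :
  cinsert (lunit A) (cnil A) [ch p] = two (lunit A) (cid p).
Proof. by rewrite /two -cids_one. Qed.

Lemma cinsert10 (A B : X) (p : loose B A) :
  cinsert (lunit B) [ch p] (cnil B) = two (cid p) (lunit B).
Proof. by rewrite /two /one (proof_irrelevance _ (capp_nil _) erefl). Qed.

Lemma lmul1l (B : X) e0 en :
  paste (two (lunit B) (cid (lid B))) (lmul B) e0 en = cid (lid B).
Proof.
rewrite -cinsert01 -[RHS](lid_factK (P := cnil B) (Q := [ch lid B])).
exact: paste_irr.
Qed.

Lemma lmul_lunit2 (B : X) e0 en :
  paste (two (lunit B) (lunit B)) (lmul B) e0 en = lunit B.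
Proof.
transitivity (paste (one (lunit B)) (cid (lid B)) (tcomp1l _) (tcomp1l _));
  last exact: paste1r.
rewrite -(lmul1l (tcomp1l _) (tcomp1l _)).
rewrite -(paste_two (lunit B) (cid (lid B)) (lmul B) (tcomp1l _) (tcomp1l _)
  (tcomp1l _) (tcomp1l _) (tcomp1l _) (tcomp1l _) (tcomp1l _) (tcomp1l _)
  (tcomp1l _) (tcomp1l _) (cells_cat_nil (one (lunit B)))).
rewrite paste1r (paste1l (P := cnil B)).
exact: paste_irr.
Qed.

Lemma lmul1r (B : X) e0 en :
  paste (two (cid (lid B)) (lunit B)) (lmul B) e0 en = cid (lid B).
Proof.
rewrite (paste_irr _ _ e0 (tcomp1l _) en (tcomp1l _)).
apply: (lid_inj (P := cnil B) (Q := cnil B)).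
rewrite cinsert00 paste1r.
rewrite -[RHS](lmul_lunit2 (tcomp1l _) (tcomp1l _)).
rewrite -(paste_two (cid (lid B)) (lunit B) (lmul B) (tcomp1l _) (tcomp1l _)
  (tcomp1l _) (tcomp1l _) (tcomp1l _) (tcomp1l _) (tcomp1l _) (tcomp1l _)
  (tcomp1l _) (tcomp1l _) (cells_cat_nilr (one (lunit B)))).
by rewrite paste1r (paste1l (P := cnil B)).
Qed.


Lemma hom_inj (B Y Z : X) (f : tight Y B) (g : tight Z B) (A0 An : X)
    (h0 : tight A0 Y) (hn : tight An Z) (k0 : tight A0 B) (kn : tight An B)
    (P : path X A0 An) (e0 : h0 >> f = k0) (en : hn >> g = kn)
    (phi psi : cell h0 hn P (hom f g)) :
  paste (one phi) (hcart f g) e0 en = paste (one psi) (hcart f g) e0 en ->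
  phi = psi.
Proof. exact: res_inj. Qed.

Lemma hfactK (B Y Z : X) (f : tight Y B) (g : tight Z B) (A0 An : X)
    (h0 : tight A0 Y) (hn : tight An Z) (k0 : tight A0 B) (kn : tight An B)
    (P : path X A0 An) (e0 e0' : h0 >> f = k0) (en en' : hn >> g = kn)
    (phi : cell k0 kn P (lid B)) :
  paste (one (res_fact (lid B) f g e0' en' phi)) (hcart f g) e0 en = phi.
Proof.
rewrite (proof_irrelevance _ e0 e0') (proof_irrelevance _ en en').
exact: res_factK.
Qed.

Lemma vertA (A0 An B0 Bn : X) (f0 : tight A0 B0) (fn : tight An Bn)
    P (q r s : loose Bn B0) (phi : cell f0 fn P q) (psi : [ch q] =>> r)
    (chi : [ch r] =>> s) :
  vert (vert phi psi) chi = vert phi (vert psi chi).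
Proof. exact: paste_one. Qed.

Lemma vert1l (A B : X) (p q : loose A B) (phi : [ch p] =>> q) :
  vert (cid p) phi = phi.
Proof. exact: paste_one1l. Qed.

Lemma vert1r (A0 An B0 Bn : X) (f0 : tight A0 B0) (fn : tight An Bn)
    P (q : loose Bn B0) (phi : cell f0 fn P q) : vert phi (cid q) = phi.
Proof. exact: paste1r. Qed.

Lemma hcomp_vert (B Y Z W : X) (f : tight Y B) (g : tight Z B) (h : tight W B)
    P Q p q (phi : P =>> p) (psi : Q =>> q) (a : [ch p] =>> hom f g)
    (b : [ch q] =>> hom g h) :
  hcomp (vert phi a) (vert psi b) = gpaste (two phi psi) (hcomp a b).
Proof. exact: (paste_two _ _ _ _ _ _ _ _ _ _ _ _ _ (cells_cat_one _ _)). Qed.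

Lemma vert_hcomp (B Y Z W : X) (f : tight Y B) (g : tight Z B) (h : tight W B)
    P Q r (phi : P =>> hom f g) (psi : Q =>> hom g h) (chi : [ch hom f h] =>> r) :
  vert (hcomp phi psi) chi = gpaste (two phi psi) (vert (mu f g h) chi).
Proof. exact: paste_one. Qed.

Lemma tr_mu (B Y Z W : X) (f : tight Y B) (g : tight Z B) (h : tight W B) e0 en :
  paste (one (mu f g h)) (hcart f h) e0 en
    = gpaste (two (hcart f g) (hcart g h)) (lmul B).
Proof. exact: hfactK. Qed.

Lemma tr_hcomp (B Y Z W : X) (f : tight Y B) (g : tight Z B) (h : tight W B)
    P Q (phi : P =>> hom f g) (psi : Q =>> hom g h)
    (e0 : tid Y >> f = f) (en : tid W >> h = h)
    (a0 : tid Y >> f = f) (an : tid Z >> g = g) (b0 : tid Z >> g = g)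
    (bn : tid W >> h = h) c0 cn :
  paste (one (hcomp phi psi)) (hcart f h) e0 en
    = paste (two (paste (one phi) (hcart f g) a0 an)
                 (paste (one psi) (hcart g h) b0 bn)) (lmul B) c0 cn.
Proof.
rewrite /hcomp /gpaste
  (paste_one _ _ _ (tcomp1l _) (tcomp1l _) (tcomp1l _) (tcomp1l _)) tr_mu.
symmetry; apply: paste_two; exact: cells_cat_one.
Qed.

Lemma tr_id2 (Y B : X) (f : tight Y B) (e0 en : tid Y >> f = f)
    (a0 an : f >> tid B = f) :
  paste (one (id2 f)) (hcart f f) e0 en
    = paste (cells_nil f) (lunit B) a0 an.
Proof. by rewrite /id2 hfactK; exact: paste_irr. Qed.

Lemma hcomp_id2l (B Y Z : X) (f : tight Y B) (g : tight Z B)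
    P (phi : P =>> hom f g) : hcomp (id2 f) phi = phi.
Proof.
apply: (hom_inj (e0 := tcomp1l _) (en := tcomp1l _)).
rewrite (tr_hcomp _ _ _ _ (tcomp1l _) (tcomp1l _) (tcomp1l _) (tcomp1l _)
  (tcomp1r _) (tcomp1r _)) (tr_id2 _ _ (tcomp1r _) (tcomp1r _)).
set psi := paste (one phi) _ _ _.
rewrite -{1}(paste1r psi (tcomp1r _) (tcomp1r _)).
rewrite (paste_two _ _ _ (tcomp1l _) (tcomp1l _) (tcomp1r _) (tcomp1r _) _ _ _ _ _ _
  (cells_cat_nil (one psi))).
by rewrite lmul1l paste1r.
Qed.

Lemma vert_precomp (B Y W : X) (f g : tight Y B) (h : tight W B)
    (eta : cnil Y =>> hom f g) (q : loose W Y) (phi : [ch q] =>> hom g h) :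
  vert phi (precomp h eta) = hcomp eta phi.
Proof.
rewrite /hcomp -[eta in RHS](paste1l (P := cnil Y) eta (tcomp1l _) (tcomp1l _)).
rewrite -[phi in RHS](paste1r phi (tcomp1r _) (tcomp1r _)) /gpaste.
rewrite (paste_two _ _ _ (tcomp1r _) (tcomp1r _) (tcomp1r _) (tcomp1r _)
  _ _ _ _ _ _ (cells_cat_nil (one phi))).
by [].
Qed.

Lemma lmap_lunit (B C : X) (k : tight B C) e0 en :
  paste (one (lunit B)) (lmap k) e0 en
    = paste (cells_nil k) (lunit C) (tcomp1r k) (tcomp1r k).
Proof.
rewrite -cinsert00 (paste_irr _ _ _ (tcomp1l _) _ (tcomp1l _)).
exact: (lid_factK (P := cnil B) (Q := cnil B)).
Qed.

Lemma lmap_lmul (B C : X) (k : tight B C)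
    (e0 en : k >> tid C = k) (a0 an : tid B >> k = k) :
  paste (two (lmap k) (lmap k)) (lmul C) e0 en
    = paste (one (lmul B)) (lmap k) a0 an.
Proof.
apply: (lid_inj (P := cnil B) (Q := [ch lid B])).
rewrite cinsert01.
rewrite -(paste_one _ _ _ _ _ _ _ (tcomp1l _) (tcomp1l _) (tcomp1l _) (tcomp1l _)).
rewrite lmul1l paste_one1l.
rewrite -(paste_two (lmap k) (lmap k) (lmul C) _ _ _ _
  (tcomp1l _) (tcomp1l _) (tcomp1l _) (tcomp1l _) (tcomp1r _) (tcomp1r _)
  (cells_cat_one (lunit B) (cid (lid B)))).
rewrite lmap_lunit paste_one1l.
rewrite -{1}(paste1r (lmap k) (tcomp1r _) (tcomp1r _)).
rewrite (paste_two _ _ _ (tcomp1l _) (tcomp1l _) (tcomp1r _) (tcomp1r _) _ _ _ _ _ _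
  (cells_cat_nil (one (lmap k)))).
by rewrite lmul1l paste1r.
Qed.

Lemma tr_act (B C Y Z : X) (k : tight B C) (f : tight Y B) (g : tight Z B)
    f' g' (ef : f >> k = f') (eg : g >> k = g') e0 en :
  paste (one (act ef eg)) (hcart f' g') e0 en
    = paste (one (hcart f g)) (lmap k) ef eg.
Proof. exact: hfactK. Qed.

Lemma act_id2 (B C Y : X) (k : tight B C) (f : tight Y B)
    f' (e e' : f >> k = f') : vert (id2 f) (act e e') = id2 f'.
Proof.
case: f' / e e' => e'; rewrite (proof_irrelevance _ e' erefl).
apply: (hom_inj (e0 := tcomp1l _) (en := tcomp1l _)).
rewrite (tr_id2 _ _ (tcomp1r _) (tcomp1r _)).
rewrite /vert /gpaste
  (paste_one _ _ _ (tcomp1l _) (tcomp1l _) (tcomp1l _) (tcomp1l _)) tr_act.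
rewrite -(paste_one _ _ _ _ _ _ _ (tcomp1l _) (tcomp1l _) erefl erefl).
rewrite (tr_id2 _ _ (tcomp1r _) (tcomp1r _)).
rewrite (paste_one _ _ _ (tcomp1l _) (tcomp1l _) erefl erefl) lmap_lunit.
apply: (pasteA (Theta := cells_nil (f >> k))).
by constructor.
Qed.

Lemma mu_act (B C Y Z W : X) (k : tight B C)
    (f : tight Y B) (g : tight Z B) (h : tight W B) f' g' h'
    (ef ef' : f >> k = f') (eg eg' : g >> k = g') (eh eh' : h >> k = h') :
  hcomp (act ef eg) (act eg' eh) = vert (mu f g h) (act ef' eh').
Proof.
apply: (hom_inj (e0 := tcomp1l _) (en := tcomp1l _)).
rewrite (tr_hcomp _ _ _ _ (tcomp1l _) (tcomp1l _) (tcomp1l _) (tcomp1l _)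
  (tcomp1r _) (tcomp1r _)) !tr_act.
rewrite /vert /gpaste
  (paste_one _ _ _ (tcomp1l _) (tcomp1l _) (tcomp1l _) (tcomp1l _)) tr_act.
rewrite -(paste_one _ _ _ ef' eh' (tcomp1l _) (tcomp1l _) (tcomp1l _) (tcomp1l _)).
rewrite tr_mu /gpaste (paste_one _ _ _ (tcomp1l _) (tcomp1l _) ef eh).
rewrite (paste_two _ _ _ (tcomp1r _) (tcomp1r _) ef eh _ _ _ _ _ _
  (cells_cat_one _ _)).
by rewrite (lmap_lmul _ _ (tcomp1l _) (tcomp1l _)).
Qed.

Lemma hcomp_act (B C Y Z W : X) (k : tight B C)
    (f : tight Y B) (g : tight Z B) (h : tight W B) f' g' h'
    (ef ef' : f >> k = f') (eg eg' : g >> k = g') (eh eh' : h >> k = h')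
    P Q (phi : P =>> hom f g) (psi : Q =>> hom g h) :
  hcomp (vert phi (act ef eg)) (vert psi (act eg' eh))
    = vert (hcomp phi psi) (act ef' eh').
Proof. by rewrite hcomp_vert vert_hcomp (mu_act ef ef' eg eg' eh eh'). Qed.

Lemma tr_hproj (B Y Z W : X) (f : tight Y B) (g : tight Z B) (x : tight W Z)
    g' (e e' : x >> g = g') e0 :
  paste (one (hproj f e)) (hcart f g) e0 e' = hcart f g'.
Proof. exact: hfactK. Qed.

Lemma tr_restr (B C Y Z W : X) (f : tight Y B) (g : tight Z B)
    (h : tight Y C) (k : tight Z C) (phi : [ch hom f g] =>> hom h k)
    (x : tight W Z) g' k' (eg : x >> g = g') (ek ek' : x >> k = k')
    (e0 : tid Y >> h = h) (en : tid W >> k' = k') (a0 : tid Y >> h = h) :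
  paste (one (restr phi eg ek)) (hcart h k') e0 en
    = paste (one (gpaste (one (hproj f eg)) phi)) (hcart h k) a0 ek'.
Proof. by rewrite /restr hfactK; exact: paste_irr. Qed.

Lemma restr_hproj (B C Y Z W : X) (f : tight Y B) (g : tight Z B)
    (h : tight Y C) (k : tight Z C) (phi : [ch hom f g] =>> hom h k)
    (x : tight W Z) g' k' (eg : x >> g = g') (ek ek' : x >> k = k')
    (e0 : tid Y >> tid Y = tid Y) (en : tid W >> x = x) :
  paste (one (restr phi eg ek)) (hproj h ek') e0 en
    = gpaste (one (hproj f eg)) phi.
Proof.
apply: (hom_inj (e0 := tcomp1l _) (en := ek)).
rewrite (paste_one _ _ _ (tcomp1l _) ek' (tcomp1l _) (tcomp1l _)) tr_hproj.
exact: tr_restr.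
Qed.

Lemma hproj_inj (B Y Z W A0 An : X) (f : tight Y B) (g : tight Z B)
    (x : tight W Z) g' (e : x >> g = g') h0 hn (k0 : tight A0 Y) (kn : tight An Z)
    e0 en P (phi psi : cell h0 hn P (hom f g')) :
  paste (one phi) (hproj f e) e0 en = paste (one psi) (hproj f e) e0 en
    :> cell k0 kn _ _ -> phi = psi.
Proof.
have ee : hn >> g' = kn >> g by rewrite -en -tcompA e.
have ff : h0 >> f = k0 >> f by rewrite -e0 tcomp1r.
move=> /(congr1 (fun c => paste (one c) (hcart f g) erefl erefl)).
rewrite !(paste_one _ _ _ (tcomp1l _) e ff ee) !tr_hproj.
exact: hom_inj.
Qed.

Lemma restr_vert (B C D Y Z W : X) (f : tight Y B) (g : tight Z B)
    (h : tight Y C) (k : tight Z C) (l : tight Y D) (m : tight Z D)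
    (phi : [ch hom f g] =>> hom h k) (psi : [ch hom h k] =>> hom l m)
    (x : tight W Z) g' k' m' (eg : x >> g = g') (ek ek' : x >> k = k')
    (em : x >> m = m') :
  vert (restr phi eg ek) (restr psi ek' em) = restr (vert phi psi) eg em.
Proof.
apply: (hproj_inj (e := em) (e0 := tcomp1r _) (en := tcomp1l _)).
rewrite restr_hproj /vert /gpaste
  (paste_one _ _ _ (tcomp1r _) (tcomp1l _) (tcomp1r _) (tcomp1l _)).
rewrite restr_hproj /gpaste.
rewrite -(paste_one _ _ _ _ _ _ _ (tcomp1r _) (tcomp1l _) (tcomp1r _) (tcomp1r _)).
by rewrite restr_hproj /gpaste (paste_one _ _ _ (tcomp1r _) (tcomp1r _) (tcomp1r _) (tcomp1r _)).
Qed.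

Lemma restr_cid (B Y Z W : X) (f : tight Y B) (g : tight Z B)
    (x : tight W Z) g' (eg eg' : x >> g = g') :
  restr (cid (hom f g)) eg eg' = cid (hom f g').
Proof.
apply: (hproj_inj (e := eg') (e0 := tcomp1r _) (en := tcomp1l _)).
rewrite restr_hproj /gpaste paste1r paste_one1l.
by rewrite (proof_irrelevance _ eg eg').
Qed.

Lemma hproj_id (B Y Z : X) (f : tight Y B) (g : tight Z B) (e : tid Z >> g = g) :
  hproj f e = cid (hom f g).
Proof.
apply: (hom_inj (e0 := tcomp1l _) (en := e)).
by rewrite tr_hproj paste_one1l.
Qed.

Lemma restr_id (B C Y Z : X) (f : tight Y B) (g : tight Z B)
    (h : tight Y C) (k : tight Z C) (phi : [ch hom f g] =>> hom h k)
    (eg : tid Z >> g = g) (ek : tid Z >> k = k) : restr phi eg ek = phi.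
Proof.
apply: (hproj_inj (e := ek) (e0 := tcomp1r _) (en := tcomp1r _)).
by rewrite restr_hproj !hproj_id /gpaste paste_one1l paste1r.
Qed.

(** The right action of [B(1, 1)] on [B(f, 1)]. *)
Definition ract (B Y : X) (f : tight Y B) :
    [ch hom f (tid B), lid B] =>> hom f (tid B) :=
  lid_fact [ch hom f (tid B)] (cnil B) (cid (hom f (tid B))).

Lemma ract1 (B Y : X) (f : tight Y B) e0 en :
  paste (two (cid (hom f (tid B))) (lunit B)) (ract f) e0 en
    = cid (hom f (tid B)).
Proof.
rewrite -cinsert10 -[RHS](lid_factK (P := [ch hom f (tid B)]) (Q := cnil B)).
exact: paste_irr.
Qed.

Lemma ract_nat (B C Y : X) (f : tight Y B) (h : tight Y C) (k : tight B C)
    (p : cell h k [ch hom f (tid B)] (lid C))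
    (e0 : tid Y >> h = h) (en : tid B >> k = k) (a0 : h >> tid C = h)
    (an : k >> tid C = k) :
  paste (one (ract f)) p e0 en = paste (two p (lmap k)) (lmul C) a0 an.
Proof.
apply: (lid_inj (P := [ch hom f (tid B)]) (Q := cnil B)).
rewrite cinsert10.
rewrite -(paste_one _ _ _ _ _ _ _ (tcomp1l _) (tcomp1l _) (tcomp1l _) (tcomp1l _)).
rewrite ract1 paste_one1l.
rewrite -(paste_two p (lmap k) (lmul C) _ _ _ _
  (tcomp1l _) (tcomp1l _) (tcomp1l _) (tcomp1l _) (tcomp1r _) (tcomp1r _)
  (cells_cat_one (cid _) (lunit B))).
rewrite lmap_lunit paste_one1l.
rewrite -{2}(paste1r p (tcomp1r _) (tcomp1r _)).
rewrite (paste_two _ _ _ (tcomp1l _) (tcomp1l _) (tcomp1r _) (tcomp1r _) _ _ _ _ _ _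
  (cells_cat_nilr (one p))).
by rewrite lmul1r paste1r.
Qed.

Lemma mu_hproj (B Y Z W : X) (f : tight Y B) (y : tight Z B) (x : tight W B) :
  paste (one (mu f y x)) (hproj f (tcomp1r x)) (tcomp1l _) (tcomp1l _)
    = paste (two (hproj f (tcomp1r y)) (hcart y x)) (ract f)
            (tcomp1l _) (tcomp1r _).
Proof.
apply: (hom_inj (e0 := tcomp1l _) (en := tcomp1r _)).
rewrite (paste_one _ _ _ (tcomp1l _) (tcomp1r _) (tcomp1l _) (tcomp1l _)) tr_hproj tr_mu.
rewrite (paste_one _ _ _ (tcomp1l _) (tcomp1r _) (tcomp1l _) (tcomp1r _)).
rewrite (ract_nat _ _ _ (tcomp1r _) (tcomp1r _)).
have -> : lmap (tid B) = cid (lid B).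
  apply: (lid_inj (P := cnil B) (Q := cnil B)).
  by rewrite cinsert00 lmap_lunit paste1r (paste1l (P := cnil B)).
rewrite -(paste_two _ _ (lmul B) _ _ _ _ (tcomp1l _) (tcomp1r _) (tcomp1r _)
  (tcomp1r _) (tcomp1r _) (tcomp1r _)
  (cells_cat_one (hproj f (tcomp1r y)) (hcart y x))).
by rewrite tr_hproj paste1r.
Qed.

Lemma restr_mu (B C Y Z W : X) (f : tight Y B) (h : tight Y C) (k : tight B C)
    (phi : [ch hom f (tid B)] =>> hom h k) (y : tight Z B) (x : tight W B)
    y' x' (ey ey' : y >> k = y') (ex ex' : x >> k = x') :
  hcomp (restr phi (tcomp1r y) ey) (act ey' ex)
    = vert (mu f y x) (restr phi (tcomp1r x) ex').
Proof.
apply: (hom_inj (e0 := tcomp1l _) (en := tcomp1l _)).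
rewrite (tr_hcomp _ _ _ _ (tcomp1l _) (tcomp1l _) (tcomp1l _) (tcomp1l _)
  (tcomp1r _) (tcomp1r _)) tr_act.
rewrite (tr_restr _ _ _ ey _ _ (tcomp1l _)).
rewrite /gpaste (paste_one _ _ _ (tcomp1l _) (tcomp1l _) (tcomp1l _) ey).
rewrite (proof_irrelevance _ ey' ey).
rewrite (paste_two _ _ _ (tcomp1r _) (tcomp1r _) (tcomp1l _) ex _ _ _ _ _ _
  (cells_cat_one _ _)).
rewrite -(ract_nat _ (tcomp1l _) (tcomp1l _)).
rewrite /vert /gpaste
  (paste_one _ _ _ (tcomp1l _) (tcomp1l _) (tcomp1l _) (tcomp1l _)).
rewrite (tr_restr _ _ _ ex _ _ (tcomp1l _)).
rewrite /gpaste (paste_one _ _ _ (tcomp1l _) (tcomp1l _) (tcomp1l _) ex).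
rewrite -[RHS](paste_one _ _ _ _ _ _ _ (tcomp1l _) (tcomp1l _) (tcomp1l _) ex).
rewrite [V in _ = paste (one V) _ _ _](mu_hproj f y x).
rewrite (paste_one _ _ _ (tcomp1l _) (tcomp1l _) (tcomp1l _) ex).
by [].
Qed.

End EquipmentTheory.

Section Adjunctions.
Variable X : virtual_equipment.

Record left_adjoint (A E C : X) (j : tight A E) (r : tight C E) : Type :=
  LeftAdjoint {
  la : tight A C;
  sharp : [ch hom la (tid C)] =>> hom j r;
  flat : [ch hom j r] =>> hom la (tid C);
  sharpK : vert sharp flat = cid (hom la (tid C));
  flatK : vert flat sharp = cid (hom j r)
}.

Section Induced.
Variables (A E C : X) (j : tight A E) (r : tight C E) (L : left_adjoint j r).
Local Notation l := (la L).

(** [sharp] and [flat] restricted along [x]; [e] stands for [x >> r]. *)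
Definition sharp_at (D : X) (x : tight D C) e (ee : x >> r = e) :
    [ch hom l x] =>> hom j e := restr (sharp L) (tcomp1r x) ee.

Definition flat_at (D : X) (x : tight D C) e (ee : x >> r = e) :
    [ch hom j e] =>> hom l x := restr (flat L) ee (tcomp1r x).

Definition ind_unit : cnil A =>> hom j (l >> r) :=
  vert (id2 l) (sharp_at erefl).

Definition ind_op (D : X) (x : tight D C) e (ee : x >> r = e) :
    [ch hom j e] =>> hom (l >> r) e := vert (flat_at ee) (act erefl ee).

Lemma sharp_atK (D : X) (x : tight D C) e (ee ee' : x >> r = e) :
  vert (sharp_at ee) (flat_at ee') = cid (hom l x).
Proof. by rewrite /sharp_at /flat_at restr_vert sharpK restr_cid. Qed.

Lemma flat_atK (D : X) (x : tight D C) e (ee ee' : x >> r = e) :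
  vert (flat_at ee) (sharp_at ee') = cid (hom j e).
Proof. by rewrite /sharp_at /flat_at restr_vert flatK restr_cid. Qed.

Lemma sharp_hcomp (Z W : X) (y : tight Z C) (x : tight W C) y' x'
    (ey ey' : y >> r = y') (ex ex' : x >> r = x') P Q
    (phi : P =>> hom l y) (psi : Q =>> hom y x) :
  hcomp (vert phi (sharp_at ey)) (vert psi (act ey' ex))
    = vert (hcomp phi psi) (sharp_at ex').
Proof. by rewrite hcomp_vert vert_hcomp /sharp_at (restr_mu _ ey ey' ex ex'). Qed.

Lemma ind_op_unit (D : X) (x : tight D C) e (ee : x >> r = e) :
  vert (ind_op ee) (precomp e ind_unit) = cid (hom j e).
Proof.
rewrite /ind_op vertA -(flat_atK ee ee); congr (vert _ _).
rewrite vert_precomp /ind_unit -[act _ _]vert1l.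
by rewrite (sharp_hcomp erefl erefl ee ee) hcomp_id2l vert1l.
Qed.

Lemma ind_op_ext (D : X) (x : tight D C) e (ee : x >> r = e) :
  hcomp (ind_op (erefl (l >> r))) (ind_op ee)
    = vert (hcomp (cid (hom j (l >> r))) (ind_op ee)) (ind_op ee).
Proof.
rewrite /ind_op (hcomp_act erefl erefl erefl erefl ee ee).
rewrite -(flat_atK (erefl (l >> r)) erefl).
rewrite (sharp_hcomp _ _ _ ee) -[RHS]vertA [vert (vert _ _) (flat_at ee)]vertA.
by rewrite sharp_atK vert1r.
Qed.

Lemma ind_unit_ext : vert ind_unit (ind_op (erefl (l >> r))) = id2 (l >> r).
Proof.
rewrite /ind_op -vertA /ind_unit [vert (vert _ _) (flat_at _)]vertA sharp_atK.
by rewrite vert1r act_id2.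
Qed.

Definition induced_monad : monad j :=
  Monad (ind_op_unit erefl) ind_unit_ext (ind_op_ext erefl).

Definition induced_op : [ch hom j r] =>> hom (l >> r) r :=
  vert (flat L) (act erefl (tcomp1l r)).

Lemma induced_opE : induced_op = ind_op (tcomp1l r).
Proof. by rewrite /induced_op /ind_op /flat_at restr_id. Qed.

Lemma induced_op_unit :
  vert induced_op (precomp r (munit induced_monad)) = cid (hom j r).
Proof. by rewrite induced_opE; exact: ind_op_unit. Qed.

Lemma induced_op_ext : hcomp (mext induced_monad) induced_op
  = vert (hcomp (cid (hom j (mt induced_monad))) induced_op) induced_op.
Proof. by rewrite induced_opE; exact: ind_op_ext. Qed.

Definition induced_algebra : algebra induced_monad C :=
  @Algebra X A E j induced_monad C r induced_op induced_op_unit induced_op_ext.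

Definition comparison (O : algebra_object induced_monad) : tight C (aoob O) :=
  aomed O induced_algebra.

End Induced.

Definition tight_iso (B C : X) (f : tight B C) : Prop :=
  exists g : tight C B, f >> g = tid B /\ g >> f = tid C.

Definition strictly_monadic (A E D : X) (j : tight A E) (r : tight D E) : Prop :=
  exists (L : left_adjoint j r) (O : algebra_object (induced_monad L)),
    tight_iso (comparison O).

(** Here [E(1, 1)] is read as [hom (tid E) (tid E)], the restriction of the
    loose-identity along identities, to which it is canonically isomorphic. *)
Definition dense (A E : X) (j : tight A E) : Prop :=
  forall Q : path X E E,
    bijective (fun phi : Q =>> hom (tid E) (tid E) =>
      hcomp (cid (hom j (tid E))) phi : ccons (hom j (tid E)) Q =>> hom j (tid E)).

End Adjunctions.

(* Main.v *)
(** Write [u] for [u_T], [l] for its left [j']-adjoint and [T'] for the induced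
    [j']-monad, with unit [eta'].  The
    action on [u], applied to [eta'] restricted along [j], is a 2-cell
    [theta : t => jlu]; restricting a [T']-algebra structure along [j] and
    composing with [theta] gives a [T]-algebra structure on the same tight-cell.
    On [u] this recovers the given action, because [(phi; u)] is a graded
    morphism for every [phi].  Hence the algebra object of [T'] has a tight-cell
    [M] to [Alg(T)], and comparison followed by [M] is the identity.  For the
    other composite, a [T']-action [I(j', e) => I(lu, e)] is itself a graded
    morphism of [T]-algebras, so it is [(eps; u)] for some
    [eps : I(j', e) => Alg(T)(l, M)]; the unit law forces [eps] to be the inverse
    of [sharp], so the action is the one transported along [M]. *)
Require Import Defs.
From mathcomp Require Import ssreflect ssrfun.
From Stdlib Require Import ProofIrrelevance.

Set Implicit Arguments.
Unset Strict Implicit.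
Unset Printing Implicit Defensive.

(** * Composition of 2-cells whose bottom is a loose-identity *)

Section Dot.
Variable X : virtual_equipment.

(** The transposed form of [hcomp]: a 2-cell into [hom f g] with identity sides corresponds to one
    into [lid B] with sides [f] and [g]. In this form restriction along tight-cells is pasting on
    top, and [e] spares transports along equalities of chains. *)
Definition dot (B A0 A1 A2 : X) (f : tight A0 B) (g : tight A1 B)
    (h : tight A2 B) P Q PQ (phi : cell f g P (lid B)) (psi : cell g h Q (lid B))
    (e : capp P Q = PQ) : cell f h PQ (lid B) :=
  paste (cells_cons phi (one psi) e) (lmul B) (tcomp1r f) (tcomp1r h).

Definition unit_cell (A B : X) (f : tight A B) : cell f f (cnil A) (lid B) :=
  paste (cells_nil f) (lunit B) (tcomp1r f) (tcomp1r f).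

(** The transposed form of [whisker]. *)
Definition push (B C A0 An : X) (k : tight B C) (f : tight A0 B) (g : tight An B)
    f' g' (ef : f >> k = f') (eg : g >> k = g') P (phi : cell f g P (lid B)) :
    cell f' g' P (lid C) :=
  paste (one phi) (lmap k) ef eg.

Lemma paste_dot (B Y0 Y1 Y2 A0 A1 A2 : X) (f : tight A0 B) (g : tight A1 B)
    (h : tight A2 B) (s0 : tight Y0 A0) (s1 : tight Y1 A1) (s2 : tight Y2 A2)
    f' g' h' P Q PQ P' Q' PQ'
    (phi : cell f g P (lid B)) (psi : cell g h Q (lid B)) (e : capp P Q = PQ)
    (Phi1 : cells s0 s1 P' P) (Phi2 : cells s1 s2 Q' Q)
    (Phi : cells s0 s2 PQ' PQ) (e' : capp P' Q' = PQ')
    (e0 : s0 >> f = f') (e1 e1' : s1 >> g = g') (e2 : s2 >> h = h')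
    (a0 : s0 >> f = f') (a2 : s2 >> h = h') :
  cells_cat Phi1 Phi2 Phi ->
  paste Phi (dot phi psi e) a0 a2
    = dot (paste Phi1 phi e0 e1) (paste Phi2 psi e1' e2) e'.
Proof.
case: PQ / e Phi => Phi; case: PQ' / e' Phi => Phi cat.
symmetry; rewrite /dot.
exact: (paste_two phi psi (lmul B) (tcomp1r f) (tcomp1r h) a0 a2
  e0 e1 e1' e2 (tcomp1r _) (tcomp1r _) cat).
Qed.

Lemma cells_cat_cons_one (A0 A1 An B0 B1 Bn : X)
    (f0 : tight A0 B0) (f1 : tight A1 B1) (fn : tight An Bn) P Q PQ p q
    (phi : cell f0 f1 P p) (psi : cell f1 fn Q q) (e : capp P Q = PQ) :
  cells_cat (one phi) (one psi) (cells_cons phi (one psi) e).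
Proof. by do 2! constructor. Qed.

Lemma paste_cids_nil (A B0 Bn : X) (f : tight A B0) (g : tight A Bn) q
    (phi : cell f g (cnil A) q) e0 en :
  paste (cells_nil (tid A)) phi e0 en = phi.
Proof. exact: (paste1l (P := cnil A)). Qed.

Lemma dot_unitl (A0 An B : X) (f : tight A0 B) (g : tight An B) P
    (phi : cell f g P (lid B)) (e : capp (cnil A0) P = P) :
  dot (unit_cell f) phi e = phi.
Proof.
rewrite -[phi in LHS](paste1r phi (tcomp1r _) (tcomp1r _)) /unit_cell.
rewrite -(paste_dot (lunit B) (cid (lid B)) erefl e (tcomp1r _) (tcomp1r _)
  (tcomp1r _) (tcomp1r _) (tcomp1r _) (tcomp1r _) (cells_cat_nil (one phi))).
by rewrite /dot lmul1l paste1r.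
Qed.

Lemma dot_unitr (A0 An B : X) (f : tight A0 B) (g : tight An B) P
    (phi : cell f g P (lid B)) (e : capp P (cnil An) = P) :
  dot phi (unit_cell g) e = phi.
Proof.
rewrite -[phi in LHS](paste1r phi (tcomp1r _) (tcomp1r _)) /unit_cell.
rewrite -(paste_dot (cid (lid B)) (lunit B) erefl e (tcomp1r _) (tcomp1r _)
  (tcomp1r _) (tcomp1r _) (tcomp1r _) (tcomp1r _) (cells_cat_nilr (one phi))).
by rewrite /dot lmul1r paste1r.
Qed.

(** By the bijection for loose-identities it suffices to compare after inserting [lunit] in the
    first of the three places, where the unit laws reduce both sides to [lmul]. *)
Lemma lmulA (B : X) :
  dot (lmul B) (cid (lid B)) erefl = dot (cid (lid B)) (lmul B) erefl.
Proof.
apply: (lid_inj (P := cnil B) (Q := [ch lid B, lid B])).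
have cat1 : cells_cat (cells_cons (lunit B) (one (cid (lid B))) erefl)
    (one (cid (lid B))) (cinsert (lunit B) (cnil B) [ch lid B, lid B]).
  by do 2! constructor; rewrite -cids_one; constructor.
have cat2 : cells_cat (one (lunit B)) (cids [ch lid B, lid B])
    (cinsert (lunit B) (cnil B) [ch lid B, lid B]).
  by do 2! constructor.
rewrite (paste_dot _ _ _ erefl (tcomp1l _) (tcomp1l _) (tcomp1l _) (tcomp1l _)
  _ _ cat1).
rewrite (paste_dot _ _ _ erefl (tcomp1l _) (tcomp1l _) (tcomp1l _) (tcomp1l _)
  _ _ cat2).
rewrite lmul1l !paste1r paste1l.
have -> : lunit B = unit_cell (tid B) by rewrite /unit_cell paste_cids_nil.
rewrite dot_unitl /dot -cids_one.
exact: (paste1l (P := [ch lid B, lid B])).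
Qed.

(** Both bracketings are the single row [phi], [psi], [chi] pasted with one of the two ternary
    multiplications of [lmulA]. *)
Lemma dotA (B A0 A1 A2 A3 : X) (f0 : tight A0 B) (f1 : tight A1 B)
    (f2 : tight A2 B) (f3 : tight A3 B) P Q R PQ QR PQR
    (phi : cell f0 f1 P (lid B)) (psi : cell f1 f2 Q (lid B))
    (chi : cell f2 f3 R (lid B)) (e : capp P Q = PQ) (e' : capp PQ R = PQR)
    (d : capp Q R = QR) (d' : capp P QR = PQR) :
  dot (dot phi psi e) chi e' = dot phi (dot psi chi d) d'.
Proof.
case: QR / d d' => d'.
set Phi := cells_cons phi (cells_cons psi (one chi) erefl) d'.
have cat1 : cells_cat (cells_cons phi (one psi) e) (one chi) Phi.
  by do 3! constructor.
have cat2 : cells_cat (one phi) (cells_cons psi (one chi) erefl) Phi.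
  by do 2! constructor.
have -> : dot phi (dot psi chi erefl) d'
    = paste Phi (dot (cid (lid B)) (lmul B) erefl) (tcomp1r _) (tcomp1r _).
  rewrite (paste_dot _ _ _ d' (tcomp1r _) (tcomp1r _) (tcomp1r _) (tcomp1r _)
    _ _ cat2) paste1r.
  by [].
rewrite -lmulA (paste_dot _ _ _ e' (tcomp1r _) (tcomp1r _) (tcomp1r _)
  (tcomp1r _) _ _ cat1) paste1r.
by [].
Qed.

End Dot.

(** * Action of a 2-cell between homs on 2-cells into loose-identities *)

Section Ext.
Variable X : virtual_equipment.

Definition cell_of (C Y Z : X) (h : tight Y C) (k : tight Z C) P
    (alpha : P =>> hom h k) : cell h k P (lid C) :=
  paste (one alpha) (hcart h k) (tcomp1l h) (tcomp1l k).

(** [alpha] applied to a 2-cell factored through [B(f, g)].  The factorization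
    may have any sides [s0], [sn], so that restrictions of [alpha] along
    tight-cells on either side need no notation of their own. *)
Definition ext (B C Y Z : X) (f : tight Y B) (g : tight Z B)
    (h : tight Y C) (k : tight Z C) (alpha : [ch hom f g] =>> hom h k)
    (A0 An : X) (s0 : tight A0 Y) (sn : tight An Z) a0 an b0 bn
    (e0 : s0 >> f = a0) (en : sn >> g = an) (d0 : s0 >> h = b0)
    (dn : sn >> k = bn) P (phi : cell a0 an P (lid B)) : cell b0 bn P (lid C) :=
  paste (one (res_fact (lid B) f g e0 en phi)) (cell_of alpha) d0 dn.

Lemma paste_fact (B Y Z A0 An Z0 Zn : X) (f : tight Y B) (g : tight Z B)
    (s0 : tight A0 Y) (sn : tight An Z) a0 an (e0 : s0 >> f = a0)
    (en : sn >> g = an) (r0 : tight Z0 A0) (rn : tight Zn An) q0 qn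
    (c0 : r0 >> s0 = q0) (cn : rn >> sn = qn) z0 zn (d0 : q0 >> f = z0)
    (dn : qn >> g = zn) (b0 : r0 >> a0 = z0) (bn : rn >> an = zn)
    P P' (phi : cell a0 an P (lid B)) (Phi : cells r0 rn P' P) :
  paste Phi (res_fact (lid B) f g e0 en phi) c0 cn
    = res_fact (lid B) f g d0 dn (paste Phi phi b0 bn).
Proof.
apply: (hom_inj (e0 := d0) (en := dn)); rewrite hfactK.
by rewrite (paste_one _ _ _ e0 en b0 bn) hfactK.
Qed.

Lemma paste_ext (B C Y Z : X) (f : tight Y B) (g : tight Z B)
    (h : tight Y C) (k : tight Z C) (alpha : [ch hom f g] =>> hom h k)
    (A0 An Z0 Zn : X) (s0 : tight A0 Y) (sn : tight An Z) a0 an b0 bn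
    (e0 : s0 >> f = a0) (en : sn >> g = an) (d0 : s0 >> h = b0)
    (dn : sn >> k = bn) (r0 : tight Z0 A0) (rn : tight Zn An) a0' an' b0' bn'
    (q0 : tight Z0 Y) (qn : tight Zn Z)
    (c0 : r0 >> b0 = b0') (cn : rn >> bn = bn') (i0 : r0 >> a0 = a0')
    (i_n : rn >> an = an') (j0 : q0 >> f = a0') (jn : qn >> g = an')
    (k0 : q0 >> h = b0') (kn : qn >> k = bn')
    P P' (phi : cell a0 an P (lid B)) (Phi : cells r0 rn P' P) :
  r0 >> s0 = q0 -> rn >> sn = qn ->
  paste Phi (ext alpha e0 en d0 dn phi) c0 cn
    = ext alpha j0 jn k0 kn (paste Phi phi i0 i_n).
Proof.
move=> l0 ln; rewrite /ext -(paste_fact _ _ l0 ln).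
by rewrite -(paste_one _ _ _ _ _ _ _ _ _ k0 kn).
Qed.

(** A Yoneda principle: [hcart] is the universal argument, at which [ext alpha] returns the
    transpose of [alpha]. Read backwards, it turns equations between 2-cells into equations between
    values of [ext]. *)
Lemma ext_hcart (B C Y Z : X) (f : tight Y B) (g : tight Z B)
    (h : tight Y C) (k : tight Z C) (alpha : [ch hom f g] =>> hom h k)
    (e0 : tid Y >> f = f) (en : tid Z >> g = g) (d0 : tid Y >> h = h)
    (dn : tid Z >> k = k) :
  ext alpha e0 en d0 dn (hcart f g) = cell_of alpha.
Proof.
rewrite /ext; have -> : res_fact (lid B) f g e0 en (hcart f g) = cid _.
  by apply: (hom_inj (e0 := e0) (en := en)); rewrite hfactK paste_one1l.
exact: paste_one1l.
Qed.

Lemma ext_fact (B C Y Z : X) (f : tight Y B) (g : tight Z B)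
    (h : tight Y C) (k : tight Z C) (alpha : [ch hom f g] =>> hom h k)
    (A0 An : X) (s0 : tight A0 Y) (sn : tight An Z) a0 an b0 bn
    (e0 : s0 >> f = a0) (en : sn >> g = an) (d0 : s0 >> h = b0)
    (dn : sn >> k = bn) P (phi : cell s0 sn P (hom f g)) e0' en' :
  ext alpha e0 en d0 dn (paste (one phi) (hcart f g) e0' en')
    = paste (one phi) (cell_of alpha) d0 dn.
Proof.
rewrite /ext; congr (paste (one _) _ _ _).
by apply: (hom_inj (e0 := e0) (en := en)); rewrite hfactK; exact: paste_irr.
Qed.

Lemma hcart_paste (B Y Z A0 An : X) (f : tight Y B) (g : tight Z B)
    (s0 : tight A0 Y) (sn : tight An Z) a0 an (e0 : s0 >> f = a0)
    (en : sn >> g = an) P (phi : cell a0 an P (lid B)) :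
  phi = paste (one (res_fact (lid B) f g e0 en phi)) (hcart f g) e0 en.
Proof. by rewrite hfactK. Qed.

Lemma cell_of_inj (C Y Z : X) (h : tight Y C) (k : tight Z C) P
    (phi psi : P =>> hom h k) : cell_of phi = cell_of psi -> phi = psi.
Proof. exact: hom_inj. Qed.

Lemma ext_id (B Y Z A0 An : X) (f : tight Y B) (g : tight Z B)
    (s0 : tight A0 Y) (sn : tight An Z) a0 an (e0 d0 : s0 >> f = a0)
    (en dn : sn >> g = an) P (phi : cell a0 an P (lid B)) :
  ext (cid (hom f g)) e0 en d0 dn phi = phi.
Proof. by rewrite /ext /cell_of paste_one1l hfactK. Qed.

Lemma cell_of_vert (C D Y Z : X) (h : tight Y C) (k : tight Z C)
    (l : tight Y D) (m : tight Z D) P (phi : P =>> hom h k)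
    (beta : [ch hom h k] =>> hom l m) :
  cell_of (vert phi beta) = paste (one phi) (cell_of beta) (tcomp1l _) (tcomp1l _).
Proof. exact: paste_one. Qed.

Lemma ext_vert (B C D Y Z : X) (f : tight Y B) (g : tight Z B)
    (h : tight Y C) (k : tight Z C) (l : tight Y D) (m : tight Z D)
    (alpha : [ch hom f g] =>> hom h k) (beta : [ch hom h k] =>> hom l m)
    (A0 An : X) (s0 : tight A0 Y) (sn : tight An Z) a0 an b0 bn c0 cn
    (e0 : s0 >> f = a0) (en : sn >> g = an) (d0 d0' : s0 >> h = b0)
    (dn dn' : sn >> k = bn) (i0 : s0 >> l = c0) (i_n : sn >> m = cn)
    P (phi : cell a0 an P (lid B)) :
  ext (vert alpha beta) e0 en i0 i_n phi
    = ext beta d0' dn' i0 i_n (ext alpha e0 en d0 dn phi).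
Proof.
rewrite [LHS]/ext cell_of_vert.
rewrite -(paste_one _ _ _ _ _ _ _ (tcomp1r s0) (tcomp1r sn) i0 i_n).
rewrite -(ext_fact beta d0' dn' _ _ _ d0 dn)
  (paste_one _ _ _ (tcomp1l _) (tcomp1l _) d0 dn).
exact: erefl.
Qed.

(** Restrictions disappear: [x] moves from the 2-cell into the right side of the factorization. By
    naturality the case of [hcart] decides, and there this is the definition of [restr]. *)
Lemma ext_restr (B C Y Z W : X) (f : tight Y B) (g : tight Z B)
    (h : tight Y C) (k : tight Z C) (alpha : [ch hom f g] =>> hom h k)
    (x : tight W Z) g' k' (eg : x >> g = g') (ek : x >> k = k')
    (A0 An : X) (s0 : tight A0 Y) (sn : tight An W) tn a0 an b0 bn
    (e0 e0' : s0 >> f = a0) (en : sn >> g' = an) (en' : tn >> g = an)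
    (d0 d0' : s0 >> h = b0) (dn : sn >> k' = bn) (dn' : tn >> k = bn)
    P (phi : cell a0 an P (lid B)) :
  sn >> x = tn ->
  ext (restr alpha eg ek) e0 en d0 dn phi = ext alpha e0' en' d0' dn' phi.
Proof.
move=> etn.
rewrite [phi](hcart_paste e0 en).
rewrite ext_fact.
have -> : cell_of (restr alpha eg ek)
   = ext alpha (tcomp1l f) eg (tcomp1l h) ek (hcart f g') (s0 := tid Y) (sn := x).
  rewrite /cell_of (tr_restr _ _ _ ek _ _ (tcomp1l _)) /gpaste.
  by rewrite (paste_one _ _ _ (tcomp1l _) (tcomp1l _) (tcomp1l _) ek).
rewrite (paste_ext alpha _ _ _ _ _ _ _ _ e0' en' d0' dn' _ _ (tcomp1r _) etn).
by rewrite (proof_irrelevance _ e0' e0).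
Qed.

Lemma ext_cell_of (C D Y Z : X) (h : tight Y C) (k : tight Z C)
    (l : tight Y D) (m : tight Z D) P (phi : P =>> hom h k)
    (beta : [ch hom h k] =>> hom l m) (e0 : tid Y >> h = h)
    (en : tid Z >> k = k) (d0 : tid Y >> l = l) (dn : tid Z >> m = m) :
  ext beta e0 en d0 dn (cell_of phi) = cell_of (vert phi beta).
Proof. by rewrite ext_fact cell_of_vert; exact: paste_irr. Qed.

Lemma cell_of_hcomp (B Y Z W : X) (f : tight Y B) (g : tight Z B)
    (h : tight W B) P Q (phi : P =>> hom f g) (psi : Q =>> hom g h) :
  cell_of (hcomp phi psi) = dot (cell_of phi) (cell_of psi) erefl.
Proof. exact: tr_hcomp. Qed.

Lemma cell_of_cid (B Y Z : X) (f : tight Y B) (g : tight Z B) :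
  cell_of (cid (hom f g)) = hcart f g.
Proof. exact: paste_one1l. Qed.

Lemma ext_act (B C Y Z A0 An : X) (k : tight B C) (f : tight Y B)
    (g : tight Z B) f' g' (ef : f >> k = f') (eg : g >> k = g')
    (s0 : tight A0 Y) (sn : tight An Z) a0 an b0 bn
    (e0 : s0 >> f = a0) (en : sn >> g = an) (d0 : s0 >> f' = b0)
    (dn : sn >> g' = bn) (c0 : a0 >> k = b0) (cn : an >> k = bn)
    P (phi : cell a0 an P (lid B)) :
  ext (act ef eg) e0 en d0 dn phi = push c0 cn phi.
Proof.
rewrite /ext /cell_of tr_act /push.
by rewrite -(paste_one _ _ _ _ _ _ _ e0 en c0 cn) hfactK.
Qed.

(** [alpha] commutes with the right action of [C(1, 1)], since both sides
    agree on the unit of [C]. *)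
Lemma ext_dot_push (B C D Y A0 A1 An : X) (f : tight Y B) (k : tight C B)
    (h : tight Y D) (m : tight C D) (alpha : [ch hom f k] =>> hom h m)
    (s0 : tight A0 Y) (y : tight A1 C) (x : tight An C) a0 y' x' b0 y'' x''
    (e0 e0' : s0 >> f = a0) (ey : y >> k = y') (ex ex' : x >> k = x')
    (d0 d0' : s0 >> h = b0) (dy dy' : y >> m = y'') (dx dx' : x >> m = x'')
    (ey' : y >> k = y')
    P Q PQ (phi : cell a0 y' P (lid B)) (psi : cell y x Q (lid C))
    (e : capp P Q = PQ) :
  ext alpha e0 ex d0 dx (dot phi (push ey ex' psi) e)
    = dot (ext alpha e0' ey' d0' dy phi) (push dy' dx' psi) e.
Proof.
have univ : ext alpha (tcomp1l f) (tcomp1l k) (tcomp1l h) (tcomp1l m)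
      (dot (hcart f k) (lmap k) erefl)
    = dot (cell_of alpha) (lmap m) erefl.
  apply: (lid_inj (P := [ch hom f k]) (Q := cnil C)); rewrite cinsert10.
  rewrite (paste_ext _ _ _ _ _ _ _ (tcomp1l _) (tcomp1l _)
    (tcomp1l f) (tcomp1l k) (tcomp1l h) (tcomp1l m) _ _ (tcomp1l _) (tcomp1l _)).
  rewrite !(paste_dot _ _ _ erefl (tcomp1l _) (tcomp1l _) (tcomp1l _)
    (tcomp1l _) _ _ (cells_cat_one (cid _) (lunit C))).
  rewrite !paste_one1l !lmap_lunit -/(unit_cell _) -/(unit_cell m).
  by rewrite !(dot_unitr (P := [ch hom f k])) ext_hcart.
have cat := cells_cat_cons_one (res_fact (lid B) f k e0' ey' phi) psi e.
have -> : dot phi (push ey ex' psi) e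
    = paste (cells_cons (res_fact (lid B) f k e0' ey' phi) (one psi) e)
        (dot (hcart f k) (lmap k) erefl) e0 ex.
  rewrite (paste_dot _ _ _ e e0' ey' ey ex' _ _ cat) hfactK.
  by [].
rewrite -(paste_ext alpha (tcomp1l f) (tcomp1l k) (tcomp1l h) (tcomp1l m)
  d0 dx e0 ex e0 ex d0 dx _ _ (tcomp1r _) (tcomp1r _)) univ.
by rewrite (paste_dot _ _ _ e d0' dy dy' dx' _ _ cat).
Qed.

(** The component of [eta] at [s], transposed. *)
Definition cell_at (B A Y : X) (f g : tight Y B) (eta : cnil Y =>> hom f g)
    (s : tight A Y) a b (e : s >> f = a) (d : s >> g = b) :
    cell a b (cnil A) (lid B) :=
  paste (cells_nil s) (cell_of eta) e d.

Lemma cell_at_id (B Y : X) (f g : tight Y B) (eta : cnil Y =>> hom f g)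
    (e : tid Y >> f = f) (d : tid Y >> g = g) :
  cell_at eta e d = cell_of eta.
Proof. exact: paste_cids_nil. Qed.

Lemma ext_hcomp_nil (B C Y Z A0 An : X) (f : tight Y B) (k : tight Z B)
    (g h : tight Y C) (m : tight Z C) (eta : cnil Y =>> hom h g)
    (alpha : [ch hom f k] =>> hom g m)
    (s0 : tight A0 Y) (sn : tight An Z) a0 an b0 bn c0
    (e0 e0' : s0 >> f = a0) (en en' : sn >> k = an) (d0 d0' : s0 >> h = b0)
    (dn dn' : sn >> m = bn) (i0 i0' : s0 >> g = c0)
    P (phi : cell a0 an P (lid B)) (e : capp (cnil A0) P = P) :
  ext (hcomp eta alpha) e0 en d0 dn phi
    = dot (cell_at eta d0' i0) (ext alpha e0' en' i0' dn' phi) e.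
Proof.
rewrite [LHS]/ext (cell_of_hcomp eta alpha).
rewrite (paste_dot _ _ _ e d0' i0 i0' dn' _ _ (cells_cat_nil (one _))).
by rewrite (proof_irrelevance _ e0' e0) (proof_irrelevance _ en' en).
Qed.

End Ext.

(** * The algebra laws in transposed form *)

Section Algebra.
Variables (X : virtual_equipment) (A E : X) (j : tight A E) (T : monad j).

Lemma ext_aop_unit (D : X) (a : algebra T D) (A0 An : X) (s0 : tight A0 A)
    (sn : tight An D) a0 an b0 (e0 e0' : s0 >> j = a0) (en en' : sn >> ae a = an)
    (d0 d0' : s0 >> mt T = b0) P (phi : cell a0 an P (lid E))
    (e : capp (cnil A0) P = P) :
  dot (cell_at (munit T) e0' d0') (ext (aop a) e0 en d0 en' phi) e = phi.
Proof.
rewrite -(ext_hcomp_nil _ _ e0 e0 en en e0' e0' en' en' d0' d0).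
by rewrite -vert_precomp aop_unit ext_id.
Qed.

(** The arguments [phi] and [psi] factor through the homs out of [j], and the law [aop_ext] is
    pasted below the resulting row. *)
Lemma ext_aop_ext (D : X) (a : algebra T D) (A0 Am An : X) (s0 : tight A0 A)
    (sm : tight Am A) (sn : tight An D) a0 b0 am bm an
    (e0 e0' : s0 >> j = a0) (d0 d0' : s0 >> mt T = b0) (em em' : sm >> j = am)
    (dm dm' dm1 dm2 : sm >> mt T = bm) (en en' en1 en2 en3 en4 : sn >> ae a = an)
    P Q PQ (phi : cell a0 bm P (lid E)) (psi : cell am an Q (lid E))
    (e e' : capp P Q = PQ) :
  dot (ext (mext T) e0 dm d0 dm' phi) (ext (aop a) em en dm1 en' psi) e
    = ext (aop a) e0' en1 d0' en2
        (dot phi (ext (aop a) em' en3 dm2 en4 psi) e').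
Proof.
have cat := cells_cat_cons_one (res_fact (lid E) j (mt T) e0 dm phi)
  (res_fact (lid E) j (ae a) em en psi) e.
transitivity (paste (cells_cons (res_fact (lid E) j (mt T) e0 dm phi)
  (one (res_fact (lid E) j (ae a) em en psi)) e)
  (cell_of (hcomp (mext T) (aop a))) d0 en').
  by rewrite cell_of_hcomp (paste_dot _ _ _ e d0 dm' dm1 en' _ _ cat).
rewrite aop_ext.
rewrite -(ext_cell_of _ _ (tcomp1l _) (tcomp1l _) (tcomp1l _) (tcomp1l _)).
rewrite (paste_ext _ _ _ _ _ _ _ e0' en1 e0' en1 d0' en2 _ _
  (tcomp1r _) (tcomp1r _)).
rewrite cell_of_hcomp cell_of_cid.
rewrite (paste_dot _ _ _ e e0 dm dm1 en' _ _ cat) hfactK.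
rewrite (proof_irrelevance _ e' e) /ext.
by rewrite (proof_irrelevance _ em' em) (proof_irrelevance _ en3 en)
  (proof_irrelevance _ dm2 dm1) (proof_irrelevance _ en4 en').
Qed.

(** [T] acting on its own carrier; the two algebra laws are monad laws. *)
Definition free_algebra : algebra T A := Algebra (mext_unit T) (mext_ext T).

End Algebra.

(** * Relative adjunctions in transposed form *)

Section Adjoint.
Variables (X : virtual_equipment) (A E C : X) (j : tight A E) (r : tight C E).
Variable L : left_adjoint j r.

(** The adjunction is determined by its unit: [sharp] respects composition on the right
    ([sharp_hcomp]), so its value at any 2-cell comes from its value at the identity of [l]. *)
Lemma ext_sharp (A0 An : X) (s0 : tight A0 A) (sn : tight An C) a0 b0 bn
    (e0 : s0 >> la L = a0) (en : sn >> tid C = sn) (d0 d0' : s0 >> j = b0)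
    (dn dn' : sn >> r = bn) (i : s0 >> (la L >> r) = a0 >> r)
    P (phi : cell a0 sn P (lid C)) (e : capp (cnil A0) P = P) :
  ext (sharp L) e0 en d0 dn phi
    = dot (cell_at (ind_unit L) d0' i) (push erefl dn' phi) e.
Proof.
have -> : sharp L = hcomp (ind_unit L) (act erefl (tcomp1l r)).
  rewrite -[sharp L](restr_id _ (tcomp1r (tid C)) (tcomp1l r)).
  rewrite -[act _ _]vert1l /ind_unit (sharp_hcomp erefl erefl _ (tcomp1l r)).
  by rewrite hcomp_id2l vert1l.
rewrite (ext_hcomp_nil _ _ e0 e0 en en d0 d0' dn dn i i _ e).
by rewrite (ext_act _ _ _ _ _ _ erefl dn').
Qed.

Lemma ext_flat_sharp (A0 An : X) (s0 : tight A0 A) (sn : tight An C) a0 b0 bn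
    (e0 e0' : s0 >> la L = a0) (en en' : sn >> tid C = sn) (d0 d0' : s0 >> j = b0)
    (dn dn' : sn >> r = bn) P (phi : cell a0 sn P (lid C)) :
  ext (flat L) d0' dn' e0' en' (ext (sharp L) e0 en d0 dn phi) = phi.
Proof. by rewrite -(ext_vert _ _ e0 en _ _ _ _ e0' en') sharpK ext_id. Qed.

Lemma ext_sharp_flat (A0 An : X) (s0 : tight A0 A) (sn : tight An C) a0 b0 bn
    (e0 e0' : s0 >> la L = a0) (en en' : sn >> tid C = sn) (d0 d0' : s0 >> j = b0)
    (dn dn' : sn >> r = bn) P (phi : cell b0 bn P (lid E)) :
  ext (sharp L) e0 en d0 dn (ext (flat L) d0' dn' e0' en' phi) = phi.
Proof. by rewrite -(ext_vert _ _ d0' dn' _ _ _ _ d0 dn) flatK ext_id. Qed.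

Lemma ext_ind_op (D A0 An : X) (x : tight D C) x' (ex : x >> r = x')
    (s0 : tight A0 A) (sn : tight An D) tn a0 an b0
    (e0 e0' : s0 >> j = a0) (en en' : sn >> x' = an) (d0 : s0 >> (la L >> r) = b0)
    (i0 : s0 >> la L = tn) (k0 : tn >> r = b0) sn'
    (i_n : sn' >> tid C = sn') (kn kn' : sn' >> r = an)
    P (phi : cell a0 an P (lid E)) :
  sn >> x = sn' ->
  ext (ind_op L ex) e0 en d0 en' phi
    = push k0 kn' (ext (flat L) e0' kn i0 i_n phi).
Proof.
move=> esn; rewrite /ind_op /flat_at.
rewrite (ext_vert _ _ _ _ i0 i0 esn esn).
rewrite (ext_act _ _ _ _ _ _ k0 kn').
by rewrite (ext_restr _ _ _ _ e0' _ kn _ i0 _ i_n).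
Qed.

End Adjoint.

(** * Comparison of [T] with the [j']-monad induced by [l] and [u] *)

Section Composite.
Variables (X : virtual_equipment) (A E I : X) (j : tight A E) (j' : tight E I).
Variables (T : monad (j >> j')) (AlgT : algebra_object T).
Local Notation uT := (aoalg AlgT).
Local Notation u := (ae (aoalg AlgT)).
Variable L : left_adjoint j' u.
Local Notation l := (la L).

(** The comparison [t => jlu] of [T] with the [(j; j')]-monad induced by
    [jl] and [u]. *)
Definition theta : cell (mt T) (j >> l >> u) (cnil A) (lid I) :=
  ext (aop uT) (s0 := tid A) (sn := j >> l) (tcomp1l _) erefl (tcomp1l _) erefl
    (cell_at (ind_unit L) (s := j) erefl (tcompA j l u)).

Definition theta_at (Z : X) (s : tight Z A) b c (d : s >> mt T = b)
    (i : s >> (j >> l >> u) = c) : cell b c (cnil Z) (lid I) :=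
  paste (cells_nil s) theta d i.

(** Naturality of [ext] carries the restriction along [s] inside the action. Unfolding [theta] this
    way makes the algebra laws of [uT] applicable to it. *)
Lemma theta_atE (Z : X) (s : tight Z A) a b c (d d' : s >> mt T = b)
    (i : s >> (j >> l >> u) = c) (e : s >> (j >> j') = a)
    (en en' : s >> (j >> l) >> u = c) (f0 : s >> j >> j' = a)
    (fn : s >> j >> (l >> u) = c) :
  theta_at d i = ext (aop uT) e en d' en' (cell_at (ind_unit L) f0 fn).
Proof.
rewrite /theta_at /theta.
rewrite (paste_ext _ _ _ _ _ _ _ e i e en d' en' _ _ (tcomp1r _) erefl).
congr (ext _ _ _ _ _ _); apply: (pasteA (Theta := cells_nil (s >> j))).
by constructor.
Qed.

(** Up to [theta], the action on [u_T] is that of the [j']-monad induced by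
    [L]: after [sharp], both are [(-; u_T)] applied to the unit. *)
Lemma ext_aop_flat (A0 An : X) (s0 : tight A0 A) (sn : tight An (aoob AlgT))
    a0 an b0 c0 t0 (e0 : s0 >> (j >> j') = a0) (en en' : sn >> u = an)
    (d0 d0' : s0 >> mt T = b0) (i : s0 >> (j >> l >> u) = c0)
    (k0 : t0 >> u = c0) (kn kn' : sn >> u = an) (f0 : s0 >> j >> j' = a0)
    (g0 : s0 >> j >> l = t0) (gn : sn >> tid _ = sn)
    P (phi : cell a0 an P (lid I)) (e : capp (cnil A0) P = P) :
  ext (aop uT) e0 en d0 en' phi
    = dot (theta_at d0' i) (push k0 kn' (ext (flat L) f0 kn g0 gn phi)) e.
Proof.
case: c0 / k0 i => i.
have en1 : s0 >> (j >> l) >> u = t0 >> u by rewrite -g0 tcompA.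
have fn : s0 >> j >> (l >> u) = t0 >> u by rewrite -g0 -!tcompA.
rewrite (theta_atE _ d0' _ e0 en1 en1 f0 fn).
rewrite -[phi in LHS](ext_sharp_flat g0 g0 gn gn f0 f0 kn kn).
rewrite (ext_sharp _ _ _ f0 _ kn' fn _ e).
have et : s0 >> (j >> l) = t0 by rewrite tcompA.
case: t0 / et g0 i fn en1 => g0 i fn en1.
exact: ext_dot_push.
Qed.

(** * From algebras of the induced monad to [T]-algebras *)

Definition pull_cell (D : X) (a : algebra (induced_monad L) D) :
    cell (mt T) (ae a) [ch hom (j >> j') (ae a)] (lid I) :=
  dot theta
    (ext (aop a) (s0 := j) (sn := tid D) erefl (tcomp1l _) (tcompA j l u)
      (tcomp1l _) (hcart (j >> j') (ae a))) erefl.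

Definition pull_op (D : X) (a : algebra (induced_monad L) D) :
    [ch hom (j >> j') (ae a)] =>> hom (mt T) (ae a) :=
  res_fact (lid I) (mt T) (ae a) (tcomp1l _) (tcomp1l _) (pull_cell a).

Lemma ext_pull_op (D : X) (a : algebra (induced_monad L) D) (A0 An : X)
    (s0 : tight A0 A) (sn : tight An D) a0 an b0 c0
    (e0 : s0 >> (j >> j') = a0) (en en' en1 en2 : sn >> ae a = an)
    (d0 d0' : s0 >> mt T = b0) (i : s0 >> (j >> l >> u) = c0)
    (f0 : s0 >> j >> j' = a0) (g0 : s0 >> j >> (l >> u) = c0)
    P (phi : cell a0 an P (lid I)) (e : capp (cnil A0) P = P) :
  ext (pull_op a) e0 en d0 en' phi
    = dot (theta_at d0' i) (ext (aop a) f0 en1 g0 en2 phi) e.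
Proof.
have pullE : cell_of (pull_op a) = pull_cell a by exact: hfactK.
rewrite [LHS]/ext pullE.
rewrite (paste_dot _ _ _ e d0' i i en2 _ _ (cells_cat_nil (one _))).
rewrite (paste_ext _ _ _ _ _ _ _ e0 en f0 en1 g0 en2 _ _ erefl (tcomp1r _)).
by rewrite hfactK.
Qed.

(** [theta] respects the extension operators, like a morphism of relative monads. The extension law
    of [uT] gathers the left side into one value of its action, which [ext_aop_flat] splits again
    into [theta] and the extension operator of the induced monad. *)
Lemma dot_ext_theta_at (A0 Am : X) (s0 : tight A0 A) (sm : tight Am A)
    a0 b0 bm cm c0 (e0 : s0 >> (j >> j') = a0) (dm dm' : sm >> mt T = bm)
    (d0 d0' : s0 >> mt T = b0) (im im' : sm >> (j >> l >> u) = cm)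
    (i0 : s0 >> (j >> l >> u) = c0) (f0 : s0 >> j >> j' = a0)
    (fm fm' : sm >> j >> (l >> u) = cm) (g0 : s0 >> j >> (l >> u) = c0)
    P (phi : cell a0 bm P (lid I)) (e e' : capp P (cnil Am) = P)
    (e1 : capp (cnil A0) P = P) :
  dot (ext (mext T) e0 dm d0 dm' phi) (theta_at dm im) e
    = dot (theta_at d0' i0)
        (ext (mext (induced_monad L)) f0 fm g0 fm' (dot phi (theta_at dm im') e')) e1.
Proof.
have em1 : sm >> (j >> l) >> u = cm by rewrite -tcompA.
have em2 : sm >> (j >> j') = sm >> j >> j' by rewrite tcompA.
rewrite (theta_atE dm dm im em2 em1 em1 erefl fm) 
  (ext_aop_ext e0 e0 d0 d0 em2 em2 dm dm' dm dm em1 em1 em1 em1 em1 em1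
    phi _ e e').
rewrite -(theta_atE dm dm im' em2 em1 em1 erefl fm).
have g0' : s0 >> j >> l >> u = c0 by rewrite -tcompA.
rewrite (ext_aop_flat e0 em1 em1 d0 d0' i0 g0' em1 em1 f0 erefl (tcomp1r _) _ e1).
congr (dot _ _ _); symmetry; apply: ext_ind_op.
by rewrite tcompA.
Qed.

Lemma pull_op_unit (D : X) (a : algebra (induced_monad L) D) :
  vert (pull_op a) (precomp (ae a) (munit T)) = cid (hom (j >> j') (ae a)).
Proof.
have f0 : tid A >> j >> j' = j >> j' by rewrite tcomp1l.
have i0 : tid A >> (j >> l >> u) = j >> l >> u by rewrite tcomp1l.
have i1 : tid A >> (j >> l) >> u = j >> l >> u by rewrite tcomp1l.
have g0 : tid A >> j >> (l >> u) = j >> l >> u by rewrite tcomp1l tcompA.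
rewrite vert_precomp; apply: cell_of_inj.
rewrite (cell_of_hcomp (munit T) (pull_op a)) cell_of_cid.
rewrite -(cell_at_id _ (tcomp1l _) (tcomp1l _)).
rewrite -(ext_hcart (pull_op a) (tcomp1l _) (tcomp1l _) (tcomp1l _) (tcomp1l _)).
rewrite (ext_pull_op (tcomp1l _) (tcomp1l _) (tcomp1l _) (tcomp1l _)
  (tcomp1l _) (tcomp1l _) (tcomp1l _) i0 f0 g0 _ erefl).
rewrite -(dotA (P := cnil A) (Q := cnil A) _ _ _ erefl erefl erefl erefl).
(* By the unit law of [uT], the unit of [T] followed by [theta] is the unit of the induced monad
   along [j]. *)
rewrite (theta_atE (tcomp1l _) (tcomp1l _) i0 (tcomp1l _) i1 i1 f0 g0) ext_aop_unit.
exact: (ext_aop_unit (T := induced_monad L) (a := a)).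
Qed.

Lemma pull_op_ext (D : X) (a : algebra (induced_monad L) D) :
  hcomp (mext T) (pull_op a)
    = vert (hcomp (cid (hom (j >> j') (mt T))) (pull_op a)) (pull_op a).
Proof.
have f0 : tid A >> j >> j' = j >> j' by rewrite tcomp1l.
have i0 : tid A >> (j >> l >> u) = j >> l >> u by rewrite tcomp1l.
have g0 : tid A >> j >> (l >> u) = j >> l >> u by rewrite tcomp1l tcompA.
apply: cell_of_inj; rewrite cell_of_hcomp.
rewrite -(ext_cell_of _ _ (tcomp1l _) (tcomp1l _) (tcomp1l _) (tcomp1l _)).
rewrite cell_of_hcomp cell_of_cid.
rewrite -(ext_hcart (mext T) (tcomp1l _) (tcomp1l _) (tcomp1l _) (tcomp1l _)).
rewrite -(ext_hcart (pull_op a) (tcomp1l _) (tcomp1l _) (tcomp1l _) (tcomp1l _)).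
rewrite !(ext_pull_op (tcomp1l _) (tcomp1l _) (tcomp1l _) (tcomp1l _)
  (tcomp1l _) (tcomp1l _) (tcomp1l _) i0 f0 g0 _ erefl).
rewrite -(dotA (P := [ch hom (j >> j') (mt T)]) (Q := cnil A)
  _ _ _ erefl erefl erefl erefl).
(* [theta] moves to the front, where both sides share it; what remains is the extension law of [a]
   along [j]. *)
rewrite (dot_ext_theta_at _ (tcomp1l _) (tcomp1l _) (tcomp1l _) (tcomp1l _)
  i0 i0 i0 f0 g0 g0 g0 _ _ erefl erefl).
refine (etrans (dotA (P := cnil A) (Q := [ch hom (j >> j') (mt T)])
  _ _ _ erefl erefl erefl erefl) _); congr (dot _ _ _).
refine (etrans (ext_aop_ext (T := induced_monad L) (a := a) f0 f0 g0 g0 f0 f0 g0 g0 g0 g0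
  (tcomp1l _) (tcomp1l _) (tcomp1l _) (tcomp1l _) (tcomp1l _) (tcomp1l _)
  _ _ erefl erefl) _).
congr (ext _ _ _ _ _ _).
exact: dotA.
Qed.

Definition pull (D : X) (a : algebra (induced_monad L) D) : algebra T D :=
  Algebra (pull_op_unit a) (pull_op_ext a).

(** Once the common factor [theta] is stripped off, the condition is the extension law of [a] along
    [j]. *)
Lemma pull_aop_graded (D : X) (a : algebra (induced_monad L) D) :
  graded_morphism (a := pull (free_algebra (induced_monad L))) (a' := pull a) (aop a).
Proof.
have f0 : tid A >> j >> j' = j >> j' by rewrite tcomp1l.
have i0 : tid A >> (j >> l >> u) = j >> l >> u by rewrite tcomp1l.
have g0 : tid A >> j >> (l >> u) = j >> l >> u by rewrite tcomp1l tcompA.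
apply: cell_of_inj.
refine (etrans (cell_of_hcomp (pull_op (free_algebra _)) (aop a)) _).
rewrite -(ext_cell_of _ _ (tcomp1l _) (tcomp1l _) (tcomp1l _) (tcomp1l _)).
rewrite cell_of_hcomp cell_of_cid.
rewrite -(ext_hcart (pull_op _) (tcomp1l _) (tcomp1l _) (tcomp1l _) (tcomp1l _)).
rewrite -(ext_hcart (aop a) (tcomp1l _) (tcomp1l _) (tcomp1l _) (tcomp1l _)).
rewrite !(ext_pull_op (tcomp1l _) (tcomp1l _) (tcomp1l _) (tcomp1l _)
  (tcomp1l _) (tcomp1l _) (tcomp1l _) i0 f0 g0 _ erefl).
refine (etrans (dotA (P := cnil A) (Q := [ch hom (j >> j') (l >> u)])
  _ _ _ erefl erefl erefl erefl) _); congr (dot _ _ _).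
exact: (ext_aop_ext (T := induced_monad L) (a := a)).
Qed.

(** This identifies the source of the 2-cell to be lifted in [aop_factor]. The tight-cell [l] lies
    over the carrier [l >> u], and by [ext_aop_flat] the action of [uT] along [l] is [theta]
    followed by the extension operator of the induced monad, so uniqueness applies. *)
Lemma aomed_pull_free : aomed AlgT (pull (free_algebra (induced_monad L))) = l.
Proof.
have f0 : tid A >> j >> j' = j >> j' by rewrite tcomp1l.
have i0 : tid A >> (j >> l >> u) = j >> l >> u by rewrite tcomp1l.
have g0 : tid A >> j >> (l >> u) = j >> l >> u by rewrite tcomp1l tcompA.
have k0 : tid A >> j >> l = j >> l by rewrite tcomp1l.
symmetry; refine (@aomed_uniq _ _ _ _ _ AlgT _ (pull (free_algebra _)) l erefl _).
apply: cell_of_inj => /=.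
rewrite -!(ext_hcart _ (tcomp1l _) (tcomp1l _) (tcomp1l _) (tcomp1l _)).
rewrite (ext_restr _ _ _ _ (tcomp1l _) _ erefl _ (tcomp1l _) _ erefl _ (tcomp1l l)).
rewrite (ext_aop_flat _ _ _ _ (tcomp1l _) i0 erefl erefl erefl f0 k0 (tcomp1r _) _ erefl).
refine (etrans _ (esym (ext_pull_op (a := free_algebra (induced_monad L)) _ _ _
  (tcomp1l _) (tcomp1l _) _ (tcomp1l _) i0 f0 g0 _ erefl))).
congr (dot _ _ _); symmetry; apply: ext_ind_op; exact: tcomp1l.
Qed.

Lemma ext_induced_op (A0 An : X) (s0 : tight A0 E) (sn : tight An (aoob AlgT)) tn
    a0 an b0 (e0 e0' : s0 >> j' = a0) (en en' : sn >> u = an)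
    (d0 : s0 >> (l >> u) = b0) (i0 : s0 >> l = tn) (k0 : tn >> u = b0)
    (i_n : sn >> tid _ = sn) (kn kn' : sn >> u = an)
    P (phi : cell a0 an P (lid I)) :
  ext (induced_op L) e0 en d0 en' phi
    = push k0 kn' (ext (flat L) e0' kn i0 i_n phi).
Proof. by rewrite induced_opE; apply: ext_ind_op; exact: tcomp1r. Qed.

(** * The comparison tight-cell and its inverse *)

Section Inverse.
Variable O : algebra_object (induced_monad L).
Local Notation o := (aoalg O).
Local Notation M := (aomed AlgT (pull (aoalg O))).
Local Notation K := (comparison O).

(** Both tight-cells mediate for the algebra [uT] itself, so uniqueness identifies them. *)
Lemma comparison_pull : K >> M = tid (aoob AlgT).
Proof.
have f0 : tid A >> j >> j' = j >> j' by rewrite tcomp1l.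
have i0 : tid A >> (j >> l >> u) = j >> l >> u by rewrite tcomp1l.
have g0 : tid A >> j >> (l >> u) = j >> l >> u by rewrite tcomp1l tcompA.
have k0 : tid A >> j >> l = j >> l by rewrite tcomp1l.
have eK : K >> ae o = u := aomedE O (induced_algebra L).
have eM : M >> u = ae o := aomedE AlgT (pull o).
have eKM : K >> M >> u = u by rewrite -tcompA eM.
transitivity (aomed AlgT uT).
  apply: (aomed_uniq (e := eKM)); apply: cell_of_inj.
  rewrite -!(ext_hcart _ (tcomp1l _) (tcomp1l _) (tcomp1l _) (tcomp1l _)).
  rewrite (ext_restr _ _ _ _ (tcomp1l _) _ eKM _ (tcomp1l _) _ eKM _ (tcomp1l _)).
  (* The restriction along [K >> M] is split: along [M] the action of [uT] becomes that of [pull o],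
     and then along [K] the action of [o] becomes the induced one. *)
  rewrite -(ext_restr _ eM eM (tcomp1l _) _ eK _ (tcomp1l _) _ eK _ _ erefl).
  have -> : restr (aop uT) eM eM = pull_op o.
    by rewrite (proof_irrelevance _ eM (aomedE AlgT (pull o))) aomed_op.
  rewrite (ext_pull_op _ _ _ eK eK _ (tcomp1l _) i0 f0 g0 _ erefl).
  rewrite (ext_aop_flat _ _ _ _ (tcomp1l _) i0 erefl (tcomp1l _) (tcomp1l _) f0 k0
    (tcomp1r _) _ erefl).
  congr (dot _ _ _).
  rewrite -(ext_restr _ eK eK f0 _ (tcomp1l _) _ g0 _ (tcomp1l _) _ _ (tcomp1l _)).
  have -> : restr (aop o) eK eK = induced_op L.
    rewrite (proof_irrelevance _ eK (aomedE O (induced_algebra L))).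
    exact: (aomed_op O (induced_algebra L)).
  exact: ext_induced_op.
symmetry; apply: (aomed_uniq (e := tcomp1l _)); exact: restr_id.
Qed.

Lemma aop_factor (eM : M >> u = ae o) :
  exists eps : [ch hom j' (ae o)] =>> hom l M, whisker eps erefl eM = aop o.
Proof.
have [eps [<- _]] := aomed2 AlgT (pull_aop_graded o).
(* The proof of [aomedE] is generalized together with [eps], because both types mention the
   mediating tight-cell about to be rewritten to [l]. *)
move: eps (aomedE AlgT (pull (free_algebra (induced_monad L)))).
rewrite aomed_pull_free => eps e; exists eps.
by rewrite (proof_irrelevance _ e erefl) (proof_irrelevance _ eM (aomedE _ _)).
Qed.

Lemma pull_comparison : M >> K = tid (aoob O).
Proof.
have eK : K >> ae o = u := aomedE O (induced_algebra L).
have eM : M >> u = ae o := aomedE AlgT (pull o).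
have eMK : M >> K >> ae o = ae o by rewrite -tcompA eK.
have lu : tid E >> (l >> u) = l >> u := tcomp1l _.
transitivity (aomed O o); last first.
  by symmetry; apply: (aomed_uniq (e := tcomp1l _)); exact: restr_id.
apply: (aomed_uniq (e := eMK)); apply: cell_of_inj.
have [eps epsE] := aop_factor eM.
have aopE : cell_of (aop o) = push erefl eM (cell_of eps).
  rewrite -epsE /whisker.
  rewrite -(ext_cell_of _ _ (tcomp1l _) (tcomp1l _) (tcomp1l _) (tcomp1l _)).
  exact: ext_act.
(* The unit law of [o] says that the unit followed by its action is the universal 2-cell. As that
   action is [eps] pushed along [u], [ext_sharp] reads this as [sharp] sending [eps] to the
   universal 2-cell; now apply [flat]. *)
have flatE : ext (flat L) (tcomp1l _) eM (tcomp1l _) (tcomp1r _) (hcart j' (ae o))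
    = cell_of eps.
  rewrite -(ext_aop_unit (T := induced_monad L) (a := o) (tcomp1l _) (tcomp1l _)
    (tcomp1l _) (tcomp1l _) (tcomp1l _) (tcomp1l _) (hcart j' (ae o)) erefl).
  rewrite ext_hcart aopE.
  refine (etrans _ (ext_flat_sharp (tcomp1l _) _ (tcomp1r _) _ (tcomp1l _) _ eM _ _)).
  by congr (ext _ _ _ _ _ _); symmetry; exact: ext_sharp.
rewrite aopE -flatE.
rewrite -(ext_hcart _ (tcomp1l _) (tcomp1l _) (tcomp1l _) (tcomp1l _)).
rewrite (ext_restr _ _ _ _ (tcomp1l _) _ eMK _ (tcomp1l _) _ eMK _ (tcomp1l _)).
(* Along [M >> K] the action of [o] is the induced action along [M], that is, [flat] followed by
   [u]. *)
rewrite -(ext_restr _ eK eK (tcomp1l _) _ eM _ lu _ eM _ _ erefl).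
have -> : restr (aop o) eK eK = induced_op L.
  rewrite (proof_irrelevance _ eK (aomedE O (induced_algebra L))).
  exact: (aomed_op O (induced_algebra L)).
exact: ext_induced_op.
Qed.

End Inverse.

End Composite.

Theorem proposition4p12 (X : virtual_equipment) (A E I : X)
  (j : tight A E) (j' : tight E I)
  (T : monad (j >> j')) (AlgT : algebra_object T) :
  dense j' ->
  (strictly_monadic j' (ae (aoalg AlgT)) <->
   exists L : left_adjoint j' (ae (aoalg AlgT)),
     inhabited (algebra_object (induced_monad L))).
Proof.
move=> _; split=> [[L [O _]]|[L [O]]]; first by exists L; constructor.
(* The inverse is the tight-cell classifying the universal algebra of the induced monad, regarded as
   a [T]-algebra. *)
exists L, O, (aomed AlgT (pull (aoalg O))).
by split; [exact: comparison_pull | exact: pull_comparison].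
Qed.
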